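(* Let $\mathfrak{X}$ be an abstract state space, $(\mathcal{U}(t))_{t\ge0}$ a substochastic $C_0$-semigroup on $\mathfrak{X}$ with generator $\mathcal{A}$, $\mathcal{B}:\mathscr{D}(\mathcal{A})\to\mathfrak{X}$ a positive linear operator with $\langle\mathbf{\Psi},(\mathcal{A}+\mathcal{B})u\rangle\le0$ for all $u\in\mathscr{D}(\mathcal{A})\cap\mathfrak{X}_+$, and let $\mathcal{G}$ be the generator of the associated minimal semigroup $(\mathcal{V}(t))_{t\ge0}$. The functional $\widehat{\mathfrak{a}}:\mathscr{D}(\mathcal{G})\to\mathbb{R}$ satisfies $\widehat{\mathfrak{a}}(v)=\mathfrak{a}_0(v)$ for any $v\in\mathscr{D}(\mathcal{A})$. Consequently, $$\widehat{\mathfrak{a}}(u)=\mathfrak{a}_0(u)\qquad\text{for all }u\in\mathscr{D}(\overline{\mathcal{A}+\mathcal{B}}).$$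
   Context: An abstract state space is a real ordered Banach space $\mathfrak{X}$ whose positive cone $\mathfrak{X}_+$ is closed, generating ($\mathfrak{X}=\mathfrak{X}_+-\mathfrak{X}_+$), and on which the norm is additive: $\|u+v\|=\|u\|+\|v\|$ for $u,v\in\mathfrak{X}_+$. $\mathbf{\Psi}\in\mathfrak{X}^\star_+$ is the positive functional with $\langle\mathbf{\Psi},u\rangle=\|u\|$ for $u\in\mathfrak{X}_+$. A linear operator is positive if it maps positive elements of its domain into $\mathfrak{X}_+$. A $C_0$-semigroup $(T(t))_{t\ge0}$ is substochastic if each $T(t)$ is positive and $\|T(t)u\|\le\|u\|$ for $u\in\mathfrak{X}_+$. Minimal semigroup: under the stated hypotheses there is a smallest (for the operator order, for each $t$) substochastic $C_0$-semigroup $(\mathcal{V}(t))_{t\ge0}$ whose generator $\mathcal{G}$ extends $(\mathcal{A}+\mathcal{B},\mathscr{D}(\mathcal{A}))$; it satisfies $(\lambda-\mathcal{G})^{-1}u=\lim_{n\to\infty}(\lambda-\mathcal{A})^{-1}\sum_{k=0}^n[\mathcal{B}(\lambda-\mathcal{A})^{-1}]^ku$ for all $\lambda>0$, $u\in\mathfrak{X}$, and $\mathcal{V}(t)u=\sum_{n\ge0}\mathcal{V}_n(t)u$. $\overline{\mathcal{A}+\mathcal{B}}$ is the closure of $(\mathcal{A}+\mathcal{B},\mathscr{D}(\mathcal{A}))$. Dyson–Phillips iterates: $\mathcal{V}_0(t)=\mathcal{U}(t)$, and $\mathcal{V}_{n+1}(t)$ is the unique bounded (positive) operator on $\mathfrak{X}$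 with $\mathcal{V}_{n+1}(t)u=\int_0^t\mathcal{V}_n(t-s)\mathcal{B}\,\mathcal{U}(s)u\,\mathrm{d}s$ for $u\in\mathscr{D}(\mathcal{A})$, $t\ge0$, $n\ge0$; one has $\int_0^t\mathcal{V}_n(s)v\,\mathrm{d}s\in\mathscr{D}(\mathcal{A})$ for $v\in\mathfrak{X}$. Functionals: $\mathfrak{a}_0(u)=-\langle\mathbf{\Psi},\mathcal{G}u\rangle$ for $u\in\mathscr{D}(\mathcal{G})$; $\mathfrak{a}$ is its restriction to $\mathscr{D}(\mathcal{A})$; and $\widehat{\mathfrak{a}}(v)=\lim_{t\to0^+}\frac1t\sum_{n=0}^\infty\mathfrak{a}\big(\int_0^t\mathcal{V}_n(s)v\,\mathrm{d}s\big)$ for $v\in\mathscr{D}(\mathcal{G})$ (the limit exists and $\widehat{\mathfrak{a}}$ is linear and continuous for the graph norm of $\mathcal{G}$). *)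

(* Defs.v *)
From Stdlib Require Import Reals.
From Coquelicot Require Import Coquelicot.

Open Scope R_scope.

(* A partially defined map (unbounded operator or functional): the values of
   [app] outside [dom] carry no meaning. *)
Record pfun (X Y : Type) := PFun { dom : X -> Prop; app :> X -> Y }.
Arguments PFun {X Y}.
Arguments dom {X Y}.
Arguments app {X Y}.

Definition maps {X Y : Type} (f : pfun X Y) (u : X) (y : Y) : Prop :=
  dom f u /\ f u = y.

Definition extends {X Y : Type} (f g : pfun X Y) : Prop :=
  forall u y, maps f u y -> maps g u y.

Definition prestrict {X Y : Type} (f : pfun X Y) (D : X -> Prop) : pfun X Y :=
  PFun (fun u => dom f u /\ D u) f.

Section StateSpace.

Context {X : CompleteNormedModule R_AbsRing}.

Record abstract_state_space (cone : X -> Prop) : Prop := {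
  cone_plus : forall u v, cone u -> cone v -> cone (plus u v);
  cone_scal : forall r u, 0 <= r -> cone u -> cone (scal r u);
  cone_pointed : forall u, cone u -> cone (opp u) -> u = zero;
  cone_closed : closed cone;
  cone_generating : forall x, exists u v, cone u /\ cone v /\ x = minus u v;
  cone_norm_additive :
    forall u v, cone u -> cone v -> norm (plus u v) = norm u + norm v
}.

(* [is_linear] includes boundedness.  Positivity of [Psi] follows from the
   second clause, which determines [Psi] since the cone is generating. *)
Definition norm_functional (cone : X -> Prop) (Psi : X -> R) : Prop :=
  is_linear Psi /\ forall u, cone u -> Psi u = norm u.

Definition linear_pfun (f : pfun X X) : Prop :=
  dom f zero /\
  (forall u v, dom f u -> dom f v ->
     dom f (plus u v) /\ f (plus u v) = plus (f u) (f v)) /\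
  (forall r u, dom f u -> dom f (scal r u) /\ f (scal r u) = scal r (f u)).

Definition positive_pfun (cone : X -> Prop) (f : pfun X X) : Prop :=
  forall u, dom f u -> cone u -> cone (f u).

Definition padd (f g : pfun X X) : pfun X X :=
  PFun (fun u => dom f u /\ dom g u) (fun u => plus (f u) (g u)).

(* The domain of the operator closure: for closable [f], the closure of the
   graph of [f] in [X * X] is the graph of its closure. *)
Definition dom_closure (f : pfun X X) (u : X) : Prop :=
  exists w, forall eps, 0 < eps ->
    exists x, dom f x /\ norm (minus x u) < eps /\ norm (minus (f x) w) < eps.

(* A semigroup is indexed by [R]; its values at negative times are irrelevant. *)
Record C0_semigroup (T : R -> X -> X) : Prop := {
  sg_bounded : forall t, 0 <= t -> is_linear (T t);
  sg_zero : forall u, T 0 u = u;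
  sg_plus : forall t s u, 0 <= t -> 0 <= s -> T (t + s) u = T t (T s u);
  sg_continuous : forall u, filterlim (fun t => T t u) (at_right 0) (locally u)
}.

Record substochastic (cone : X -> Prop) (T : R -> X -> X) : Prop := {
  ss_C0 : C0_semigroup T;
  ss_positive : forall t u, 0 <= t -> cone u -> cone (T t u);
  ss_contractive : forall t u, 0 <= t -> cone u -> norm (T t u) <= norm u
}.

Definition generator (T : R -> X -> X) (G : pfun X X) : Prop :=
  forall u w, maps G u w <->
    filterlim (fun t => scal (/ t) (minus (T t u) u)) (at_right 0) (locally w).

Definition minimal_semigroup (cone : X -> Prop) (A B : pfun X X)
    (V : R -> X -> X) (G : pfun X X) : Prop :=
  (substochastic cone V /\ generator V G /\ extends (padd A B) G) /\
  forall (W : R -> X -> X) (H : pfun X X),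
    substochastic cone W -> generator W H -> extends (padd A B) H ->
    forall t u, 0 <= t -> cone u -> cone (minus (W t u) (V t u)).

Record dyson_phillips (cone : X -> Prop) (U : R -> X -> X) (A B : pfun X X)
    (Vn : nat -> R -> X -> X) : Prop := {
  dp_0 : forall t u, 0 <= t -> Vn 0%nat t u = U t u;
  dp_bounded : forall n t, 0 <= t -> is_linear (Vn (S n) t);
  dp_positive : forall n t u, 0 <= t -> cone u -> cone (Vn (S n) t u);
  dp_S : forall n t u, 0 <= t -> dom A u ->
    is_RInt (fun s => Vn n (t - s) (B (U s u))) 0 t (Vn (S n) t u)
}.

Definition a0_fun (Psi : X -> R) (G : pfun X X) : pfun X R :=
  PFun (dom G) (fun u => - Psi (G u)).

Definition a_fun (Psi : X -> R) (A G : pfun X X) : pfun X R :=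
  prestrict (a0_fun Psi G) (dom A).

(* [is_ahat Psi A G Vn v l]: [v] is in the domain [dom G] of the functional,
   the series and the limit defining its value at [v] exist, and the value is
   [l].  Here [J n t] is the integral of [s |-> Vn n s v] over [[0, t]],
   [c n t] is the value of [a_fun] at [J n t] (so [J n t] lies in [dom A]),
   and [sigma t] is the sum of [c n t] over [n]. *)
Definition is_ahat (Psi : X -> R) (A G : pfun X X) (Vn : nat -> R -> X -> X)
    (v : X) (l : R) : Prop :=
  dom G v /\
  exists (J : nat -> R -> X) (c : nat -> R -> R) (sigma : R -> R),
    (forall n t, 0 < t -> is_RInt (fun s => Vn n s v) 0 t (J n t)) /\
    (forall n t, 0 < t -> maps (a_fun Psi A G) (J n t) (c n t)) /\
    (forall t, 0 < t -> is_series (fun n => c n t) (sigma t)) /\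
    filterlim (fun t => / t * sigma t) (at_right 0) (locally l).

End StateSpace.

(* Main.v *)
(* Write J_n(t)v for the integral of V_n(s)v over [0,t] and a(u) = -<Psi,(A+B)u>.
   The Dyson-Phillips iterates satisfy V_n(t+s) = sum_k V_(n-k)(t) V_k(s), and V_(n+1)(h)u/h
   tends to V_n(0)Bu on dom A.  Hence the difference quotients of J_n(t)v, computed in two
   ways, give J_n(t)v in dom A with
     A J_n(t)v + B J_(n-1)(t)v = V_n(t)v - V_n(0)v,
   and for v in dom A also V_n(t)v - V_n(0)v = J_n(t)Av + J_(n-1)(t)Bv.
   The first identity telescopes: sigma_t(v) = sum_n a(J_n(t)v) converges, is linear in v, and
   0 <= sigma_t(v) <= <Psi, v - U(t)v> for positive v.  Applying a to the second one and
   integrating in t, sigma_t(v) - t a(v) = int_0^t sigma_s((A+B)v) ds.  So if (A+B)v is the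
   difference of the positive elements w1 and w2, then |sigma_t(v) - t a(v)| is at most t times
   the sum of the <Psi, w_i - U(t)w_i>, which tend to 0.  This estimate survives passage to the
   closure of the graph of A+B, and there (A+B)v becomes Gv because G is closed.  The equality
   of V with the sum of the V_n is never needed.  Continuity of sigma_t and the graph bound for
   B come from bounded decompositions x = u - v into positive elements (Klee-Ando). *)

(* The obstacle is that [ell], the functional written a above, lives only on [dom A] and is
   controlled only by the graph norm of [A], whereas the sums and integrals converge in [X]. Two
   devices overcome it. First, [B] factors as [B u = L (u - A u)] with a bounded operator [L], which
   is B(1-A)^(-1); whatever converges or is integrable together with its image under [A] can then be
   passed through [B]. Second, the integral of sigma_s is never formed. The identity is integrated
   for the partial sum up to [N]; for positive [w] the numbers [c n s w] increase with [s], so the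
   integrand is bounded by values at the final time [t]; only then does [N] tend to infinity. The
   partial identity carries an extra term [c N s (B v)], which disappears in the limit because its
   bounds at time [t] are general terms of convergent series. *)
Require Import Defs.
From Stdlib Require Import Reals Lra Lia List Classical IndefiniteDescription.
From Coquelicot Require Import Coquelicot.

Open Scope R_scope.

(** * Linear identities in modules *)

Section ModuleEquations.

Context {V : NormedModule R_AbsRing}.

(** Syntax for proof by reflection: an identity between linear combinations reduces to one real
    identity per atom, namely equality of the coefficients computed by [mcoef]. *)
Inductive mexp :=
| MZero | MVar (n : nat) | MPlus (a b : mexp) | MOpp (a : mexp) | MScal (r : R) (a : mexp).

Fixpoint mdenote (l : list V) (e : mexp) : V :=
  match e with
  | MZero => zero
  | MVar n => nth n l zero
  | MPlus a b => plus (mdenote l a) (mdenote l b)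
  | MOpp a => opp (mdenote l a)
  | MScal r a => scal r (mdenote l a)
  end.

Fixpoint mcoef (e : mexp) (i : nat) : R :=
  match e with
  | MZero => 0
  | MVar n => if Nat.eqb n i then 1 else 0
  | MPlus a b => mcoef a i + mcoef b i
  | MOpp a => - mcoef a i
  | MScal r a => r * mcoef a i
  end.

Fixpoint lincomb (f : nat -> R) (l : list V) : V :=
  match l with
  | nil => zero
  | x :: l' => plus (scal (f O) x) (lincomb (fun i => f (S i)) l')
  end.

Fixpoint coef_eqs (f g : nat -> R) (l : list V) : Prop :=
  match l with
  | nil => True
  | _ :: l' => f O = g O /\ coef_eqs (fun i => f (S i)) (fun i => g (S i)) l'
  end.

Lemma lincomb_ext (f g : nat -> R) (l : list V) :
  coef_eqs f g l -> lincomb f l = lincomb g l.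
Proof.
  revert f g; induction l as [|x l IH]; intros f g; simpl; [easy|].
  intros [H1 H2]; now rewrite H1, (IH _ _ H2).
Qed.

Lemma lincomb_zero (l : list V) : lincomb (fun _ => 0) l = zero.
Proof.
  induction l as [|x l IH]; simpl; [easy|].
  rewrite IH, plus_zero_r. exact (scal_zero_l x).
Qed.

Lemma plus_swap4 (a b c d : V) : plus (plus a b) (plus c d) = plus (plus a c) (plus b d).
Proof.
  rewrite <- !plus_assoc; f_equal.
  now rewrite !plus_assoc, (plus_comm b c).
Qed.

Lemma lincomb_plus (f g : nat -> R) (l : list V) :
  lincomb (fun i => f i + g i) l = plus (lincomb f l) (lincomb g l).
Proof.
  revert f g; induction l as [|x l IH]; intros f g; simpl.
  - now rewrite plus_zero_l.
  - rewrite (IH (fun i => f (S i)) (fun i => g (S i))), plus_swap4; f_equal.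
    exact (scal_distr_r (f O) (g O) x).
Qed.

Lemma lincomb_scal (r : R) (f : nat -> R) (l : list V) :
  lincomb (fun i => r * f i) l = scal r (lincomb f l).
Proof.
  revert f; induction l as [|x l IH]; intros f; simpl.
  - symmetry; exact (scal_zero_r r).
  - rewrite (IH (fun i => f (S i))).
    etransitivity; [|symmetry; exact (scal_distr_l r (scal (f O) x) _)].
    f_equal; symmetry; exact (scal_assoc r (f O) x).
Qed.

Lemma lincomb_var (n : nat) (l : list V) :
  lincomb (fun i => if Nat.eqb n i then 1 else 0) l = nth n l zero.
Proof.
  revert n; induction l as [|x l IH]; intros [|n]; simpl; try easy.
  - rewrite lincomb_zero, plus_zero_r. exact (scal_one x).
  - rewrite IH. etransitivity; [apply f_equal2; [exact (scal_zero_l x)|reflexivity]|].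
    apply plus_zero_l.
Qed.

Lemma mdenote_lincomb (l : list V) (e : mexp) : mdenote l e = lincomb (mcoef e) l.
Proof.
  induction e as [|n|a IHa b IHb|a IHa|r a IHa]; simpl.
  - now rewrite lincomb_zero.
  - now rewrite lincomb_var.
  - now rewrite IHa, IHb, lincomb_plus.
  - rewrite IHa. etransitivity; [symmetry; exact (scal_opp_one (lincomb (mcoef a) l))|].
    change (opp one) with (-1).
    rewrite <- lincomb_scal. apply lincomb_ext.
    generalize (mcoef a); clear; intro f; revert f.
    induction l as [|x l IH]; intro f; simpl; [easy|]; split; [ring|apply IH].
  - now rewrite IHa, lincomb_scal.
Qed.

Lemma mexp_eq (l : list V) (a b : mexp) :
  coef_eqs (mcoef a) (mcoef b) l -> mdenote l a = mdenote l b.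
Proof. intro H; rewrite !mdenote_lincomb; now apply lincomb_ext. Qed.

End ModuleEquations.

(* Atoms are compared syntactically, so convertible but different canonical-structure paths
   inside an atom make [module_eq] leave false coefficient equations. *)
Ltac mod_mem x l :=
  lazymatch l with
  | nil => constr:(false)
  | x :: _ => constr:(true)
  | _ :: ?l' => mod_mem x l'
  end.

Ltac mod_index x l :=
  lazymatch l with
  | x :: _ => constr:(O)
  | _ :: ?l' => let n := mod_index x l' in constr:(S n)
  end.

Ltac mod_atoms e l :=
  lazymatch e with
  | plus ?a ?b => let l1 := mod_atoms a l in mod_atoms b l1
  | minus ?a ?b => let l1 := mod_atoms a l in mod_atoms b l1
  | opp ?a => mod_atoms a l
  | scal _ ?a => mod_atoms a l
  | zero => l
  | _ => lazymatch mod_mem e l with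
         | true => l
         | false => constr:(e :: l)
         end
  end.

Ltac mod_reify e l :=
  lazymatch e with
  | plus ?a ?b => let x := mod_reify a l in let y := mod_reify b l in constr:(MPlus x y)
  | minus ?a ?b => let x := mod_reify a l in let y := mod_reify b l in constr:(MPlus x (MOpp y))
  | opp ?a => let x := mod_reify a l in constr:(MOpp x)
  | scal ?r ?a => let x := mod_reify a l in constr:(MScal r x)
  | zero => constr:(MZero)
  | _ => let n := mod_index e l in constr:(MVar n)
  end.

Ltac module_eq_with tac :=
  lazymatch goal with
  | |- @eq ?T ?a ?b =>
    let l0 := mod_atoms a (@nil T) in
    let l := mod_atoms b l0 in
    let x := mod_reify a l in
    let y := mod_reify b l in
    refine (@mexp_eq _ l x y _); cbn [coef_eqs mcoef Nat.eqb]; repeat split; tac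
  end.

Ltac module_eq := module_eq_with ltac:(try ring).

(** * Norms, right limits and integrals *)

Section NormedModules.

Context {V : NormedModule R_AbsRing}.
Implicit Types x y z : V.

(** The lower bound is the upper bound [norm_scal] applied to the factor [/ k] and the vector
    [scal k x]. *)
Lemma norm_scal_eq (k : R) x : norm (scal k x) = Rabs k * norm x.
Proof.
  apply Rle_antisym; [exact (norm_scal k x)|].
  destruct (Req_dec k 0) as [->|Hk].
  { rewrite Rabs_R0, Rmult_0_l; apply norm_ge_0. }
  assert (H : norm x <= / Rabs k * norm (scal k x)).
  { rewrite <- Rabs_inv. eapply Rle_trans; [|exact (norm_scal (/ k) (scal k x))].
    right; f_equal; symmetry.
    transitivity (scal (/ k * k) x); [symmetry|].
    - module_eq_with ltac:(field; exact Hk).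
    - module_eq_with ltac:(field; exact Hk). }
  pose proof (Rabs_pos_lt k Hk).
  replace (norm (scal k x)) with (Rabs k * (/ Rabs k * norm (scal k x))) by (field; lra).
  apply Rmult_le_compat_l; lra.
Qed.

Lemma norm_of_scal (k : R) x y : x = scal k y -> norm x = Rabs k * norm y.
Proof. intros ->; apply norm_scal_eq. Qed.

Lemma norm_of_plus x y z : x = plus y z -> norm x <= norm y + norm z.
Proof. intros ->; apply norm_triangle. Qed.

Lemma norm_minus_sym x y : norm (minus x y) = norm (minus y x).
Proof. rewrite <- norm_opp; f_equal; module_eq. Qed.

Lemma norm_minus_triangle x y z : norm (minus x z) <= norm (minus x y) + norm (minus y z).
Proof. replace (minus x z) with (plus (minus x y) (minus y z)) by module_eq; apply norm_triangle. Qed.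

Lemma norm_minus_le x y : norm (minus x y) <= norm x + norm y.
Proof. rewrite <- (norm_opp y); apply norm_triangle. Qed.

Lemma norm_le_minus x y : norm x <= norm y + norm (minus x y).
Proof. replace x with (plus y (minus x y)) at 1 by module_eq; apply norm_triangle. Qed.

Lemma minus_zero_eq x y : minus x y = zero -> x = y.
Proof.
  intro H; replace x with (plus (minus x y) y) by module_eq; rewrite H; module_eq.
Qed.

Lemma norm_minus_eq0 x y : x = y -> norm (minus x y) = 0.
Proof. intros ->; rewrite <- (norm_zero (V := V)); f_equal; module_eq. Qed.

Lemma eq_of_norm_lt x y : (forall eps, 0 < eps -> norm (minus x y) < eps) -> x = y.
Proof.
  intro H; apply minus_zero_eq, norm_eq_zero.
  destruct (Req_dec (norm (minus x y)) 0) as [|Hn]; [easy|exfalso].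
  pose proof (norm_ge_0 (minus x y)).
  specialize (H (norm (minus x y))); lra.
Qed.

End NormedModules.

Lemma linear_quotient {V W : NormedModule R_AbsRing} (L : V -> W) (HL : is_linear L) (r : R) (x y : V) :
  L (scal r (minus x y)) = scal r (minus (L x) (L y)).
Proof. rewrite <- (linear_minus L) by exact HL; exact (linear_scal L HL r (minus x y)). Qed.

Lemma linear_scal_R {V W : NormedModule R_AbsRing} (L : V -> W) (HL : is_linear L) (r : R) (x : V) :
  L (scal r x) = scal r (L x).
Proof. exact (linear_scal L HL r x). Qed.

Lemma is_linear_add {V W : NormedModule R_AbsRing} (f g : V -> W) :
  is_linear f -> is_linear g -> is_linear (fun x => plus (f x) (g x)).
Proof.
  intros Hf Hg.
  exact (is_linear_comp (fun x => (f x, g x)) (fun p => plus (fst p) (snd p))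
    (is_linear_prod f g Hf Hg) is_linear_plus).
Qed.

Lemma is_linear_sum_n {V W : NormedModule R_AbsRing} (f : nat -> V -> W) n :
  (forall k, (k <= n)%nat -> is_linear (f k)) -> is_linear (fun x => sum_n (fun k => f k x) n).
Proof.
  induction n as [|n IH]; intro H.
  - apply (is_linear_ext (f O)); [intro x; now rewrite sum_O|now apply H].
  - apply (is_linear_ext (fun x => plus (sum_n (fun k => f k x) n) (f (S n) x))).
    + intro x; now rewrite sum_Sn.
    + apply is_linear_add; [apply IH; intros; apply H; lia|apply H; lia].
Qed.

Section ClosedSets.

Context {V : NormedModule R_AbsRing}.

Lemma closed_eps (D : V -> Prop) (HD : closed D) (x : V) :
  (forall eps, 0 < eps -> exists y, D y /\ norm (minus y x) < eps) -> D x.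
Proof.
  intro H; apply HD; intros [e He].
  destruct (H e (cond_pos e)) as (y & Dy & Hy).
  apply (He y); [apply norm_compat1|]; easy.
Qed.

End ClosedSets.

Notation rlim f l := (filterlim f (at_right 0) (locally l)).

Section RightLimits.

Context {V : NormedModule R_AbsRing}.
Implicit Types f g : R -> V.

Lemma rlim_eps f (l : V) :
  rlim f l <->
  forall eps, 0 < eps -> exists d, 0 < d /\ forall h, 0 < h < d -> norm (minus (f h) l) < eps.
Proof.
  rewrite filterlim_locally_ball_norm; split.
  - intros H eps He; destruct (H (mkposreal eps He)) as [d Hd].
    exists d; split; [apply cond_pos|intros h Hh].
    apply (Hd h); [|lra].
    change (Rabs (minus h 0) < d); unfold minus, plus, opp; simpl.
    rewrite Rabs_pos_eq; lra.
  - intros H eps; destruct (H eps (cond_pos eps)) as (d & Hd & Hf).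
    exists (mkposreal d Hd); intros h Hh Hp; apply Hf.
    change (Rabs (minus h 0) < d) in Hh; unfold minus, plus, opp in Hh; simpl in Hh.
    rewrite Rabs_pos_eq in Hh; lra.
Qed.

(** Admitting [h = 0] matters for integrands on a closed interval, where both [s = 0] and
    [h - s = 0] occur. *)
Lemma rlim_eps_0 f :
  rlim f (f 0) ->
  forall eps, 0 < eps -> exists d, 0 < d /\ forall h, 0 <= h < d -> norm (minus (f h) (f 0)) < eps.
Proof.
  rewrite rlim_eps; intros H eps He; destruct (H eps He) as (d & Hd & Hf).
  exists d; split; [easy|]; intros h Hh.
  destruct (Req_dec h 0) as [->|Hne]; [now rewrite norm_minus_eq0|apply Hf; lra].
Qed.

Lemma rlim_ext f g (l : V) : (forall h, 0 < h -> f h = g h) -> rlim f l -> rlim g l.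
Proof.
  intros E; rewrite !rlim_eps; intros H eps He.
  destruct (H eps He) as (d & Hd & Hf); exists d; split; [easy|intros h Hh].
  rewrite <- E; [now apply Hf|lra].
Qed.

Lemma rlim_unique f (l l' : V) : rlim f l -> rlim f l' -> l = l'.
Proof. apply filterlim_locally_unique; apply at_right_proper_filter. Qed.

Lemma rlim_const (l : V) : rlim (fun _ => l) l.
Proof. apply filterlim_const. Qed.

Lemma rlim_plus f g (l l' : V) :
  rlim f l -> rlim g l' -> rlim (fun h => plus (f h) (g h)) (plus l l').
Proof.
  intros Hf Hg; eapply filterlim_comp_2; [exact Hf|exact Hg|apply filterlim_plus].
Qed.

Lemma rlim_linear {W : NormedModule R_AbsRing} (L : V -> W) f (l : V) :
  is_linear L -> rlim f l -> rlim (fun h => L (f h)) (L l).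
Proof.
  intros HL Hf; eapply filterlim_comp; [exact Hf|apply linear_cont, HL].
Qed.

Lemma rlim_scal (k : R) f (l : V) : rlim f l -> rlim (fun h => scal k (f h)) (scal k l).
Proof.
  apply (rlim_linear (fun x => scal k x)).
  exact (is_linear_scal_r (K := R_AbsRing) k (fun n m => Rmult_comm n m)).
Qed.

Lemma rlim_minus f g (l l' : V) :
  rlim f l -> rlim g l' -> rlim (fun h => minus (f h) (g h)) (minus l l').
Proof.
  intros Hf Hg; apply rlim_plus; [easy|].
  apply (rlim_linear opp); [apply is_linear_opp|easy].
Qed.

Lemma rlim_sum_n (F : nat -> R -> V) (l : nat -> V) n :
  (forall k, (k <= n)%nat -> rlim (F k) (l k)) ->
  rlim (fun h => sum_n (fun k => F k h) n) (sum_n l n).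
Proof.
  induction n as [|n IH]; intro H.
  - rewrite sum_O; apply (rlim_ext (F O)); [intros h _; now rewrite sum_O|now apply H].
  - rewrite sum_Sn; apply (rlim_ext (fun h => plus (sum_n (fun k => F k h) n) (F (S n) h)));
      [intros h _; now rewrite sum_Sn|].
    apply rlim_plus; [apply IH; intros; apply H; lia|apply H; lia].
Qed.

Lemma rlim_norm_le f (l : V) (g : R -> R) :
  (forall h, 0 < h -> norm (minus (f h) l) <= g h) -> rlim g 0 -> rlim f l.
Proof.
  intros Hle; rewrite (rlim_eps f).
  intros Hg eps He. apply (proj1 (filterlim_locally_ball_norm g 0)) with (eps := mkposreal eps He) in Hg.
  destruct Hg as [d Hd]; exists d; split; [apply cond_pos|intros h Hh].
  apply Rle_lt_trans with (1 := Hle h (proj1 Hh)).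
  assert (Hb : ball 0 d h).
  { change (Rabs (minus h 0) < d); unfold minus, plus, opp; simpl.
    rewrite Rabs_pos_eq; lra. }
  specialize (Hd h Hb (proj1 Hh)).
  change (Rabs (minus (g h) 0) < eps) in Hd; unfold minus, plus, opp in Hd; simpl in Hd.
  apply Rabs_def2 in Hd; lra.
Qed.

Lemma rlim_closed (D : V -> Prop) (HD : closed D) f (l : V) :
  (forall h, 0 < h -> D (f h)) -> rlim f l -> D l.
Proof.
  intros Hf; rewrite rlim_eps; intro H; apply (closed_eps D HD); intros eps He.
  destruct (H eps He) as (d & Hd & Hh); exists (f (d / 2)); split.
  - apply Hf; lra.
  - apply Hh; lra.
Qed.

End RightLimits.

Lemma rlim_id : rlim (fun h : R => h) 0.
Proof.
  apply (rlim_eps (V := R_NormedModule) (fun h => h) 0); intros eps He; exists eps; split; [easy|].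
  intros h Hh; change (Rabs (h + - 0) < eps); rewrite Rabs_pos_eq; lra.
Qed.

Lemma rlim_ge0 (f : R -> R) (l : R) : (forall h, 0 < h -> 0 <= f h) -> rlim f l -> 0 <= l.
Proof. apply (rlim_closed (V := R_NormedModule)), closed_ge. Qed.

Lemma rlim_norm {V : NormedModule R_AbsRing} (f : R -> V) (l : V) :
  rlim f l -> rlim (fun h => norm (minus (f h) l)) 0.
Proof.
  rewrite rlim_eps; intro H; apply (rlim_eps (V := R_NormedModule)).
  intros eps He; destruct (H eps He) as (d & Hd & Hf); exists d; split; [easy|].
  intros h Hh; change (Rabs (norm (minus (f h) l) + - 0) < eps).
  rewrite Ropp_0, Rplus_0_r, Rabs_pos_eq; [now apply Hf|apply norm_ge_0].
Qed.

Section CompleteModules.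

Context {X0 : CompleteNormedModule R_AbsRing}.
Local Notation X := (CompleteNormedModule.NormedModule R_AbsRing X0).

Lemma complete_seq (u : nat -> X) :
  (forall eps, 0 < eps -> exists N, forall n m, (N <= n)%nat -> (N <= m)%nat ->
     norm (minus (u n) (u m)) < eps) ->
  exists l, forall eps, 0 < eps -> exists N, forall n, (N <= n)%nat -> norm (minus (u n) l) < eps.
Proof.
  intro H.
  destruct (proj1 (filterlim_locally_cauchy (F := eventually) u)) as [l Hl].
  - intro eps; destruct (H eps (cond_pos eps)) as [N HN].
    exists (fun n => (N <= n)%nat); split; [now exists N|].
    intros n m Hn Hm; apply (norm_compat1 (V := X) (u n) (u m)), HN; easy.
  - exists l; intros eps He.
    destruct (proj1 (filterlim_locally_ball_norm u l) Hl (mkposreal eps He)) as [N HN].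
    exists N; exact HN.
Qed.

End CompleteModules.

Section Integrals.

Context {V : NormedModule R_AbsRing}.
Implicit Types f g : R -> V.

(** A linear map commutes with every Riemann sum, and its continuity carries the limit. *)
Lemma is_RInt_linear {W : NormedModule R_AbsRing} (L : V -> W) (HL : is_linear L) f a b (I : V) :
  is_RInt f a b I -> is_RInt (fun s => L (f s)) a b (L I).
Proof.
  unfold is_RInt; intro H.
  assert (E : forall ptd, Riemann_sum (fun s => L (f s)) ptd = L (Riemann_sum f ptd)).
  { apply SF_cons_ind; [intros x0; symmetry; exact (linear_zero L HL)|].
    intros h s IH; rewrite !Riemann_sum_cons, IH.
    rewrite (linear_plus L HL); f_equal; symmetry.
    exact (linear_scal L HL (SF_h s - fst h) (f (snd h))). }
  apply (filterlim_ext (fun ptd => L (scal (sign (b - a)) (Riemann_sum f ptd)))).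
  { intros ptd; rewrite E; exact (linear_scal L HL (sign (b - a)) (Riemann_sum f ptd)). }
  eapply filterlim_comp; [exact H|apply linear_cont, HL].
Qed.

Lemma is_RInt_cone (D : V -> Prop) f a b (I : V) :
  closed D -> D zero -> (forall x y, D x -> D y -> D (plus x y)) ->
  (forall r x, 0 <= r -> D x -> D (scal r x)) ->
  a <= b -> (forall s, a < s < b -> D (f s)) -> is_RInt f a b I -> D I.
Proof.
  intros Dc D0 Dp Ds Hab Hf HI.
  (* The tags of a subdivision may be endpoints, where nothing is known about [f]. Putting zero
     outside the open interval keeps the integral and places every value in [D]. *)
  set (g := fun s => if Rlt_dec a s then if Rlt_dec s b then f s else zero else zero).
  assert (Hg : forall s, D (g s)).
  { intro s; unfold g; destruct (Rlt_dec a s); [destruct (Rlt_dec s b)|]; auto. }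
  assert (HIg : is_RInt g a b I).
  { apply is_RInt_ext with (2 := HI); intros s Hs; rewrite Rmin_left, Rmax_right in Hs by easy.
    unfold g; destruct (Rlt_dec a s); [destruct (Rlt_dec s b)|]; easy || lra. }
  assert (E : forall ptd, pointed_subdiv ptd -> D (Riemann_sum g ptd)).
  { apply (SF_cons_ind (fun ptd => pointed_subdiv ptd -> D (Riemann_sum g ptd))).
    { intros x0 _; exact D0. }
    intros h s IH Hp; rewrite Riemann_sum_cons; apply Dp; [apply Ds|].
    - destruct (Hp O) as [H1 H2].
      { rewrite SF_size_cons; lia. }
      assert (fst h <= SF_h s) by (eapply Rle_trans; [exact H1|exact H2]); lra.
    - apply Hg.
    - apply IH, (ptd_cons h), Hp. }
  apply (closed_eps D Dc); intros eps He.
  pose proof (proj1 (filterlim_locally_ball_norm _ _) HIg (mkposreal eps He)) as HF.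
  (* Pointed subdivisions have ordered nodes, so all weights in their Riemann sums are
     nonnegative. *)
  assert (HP : Riemann_fine a b (fun ptd => pointed_subdiv ptd)).
  { exists (mkposreal 1 Rlt_0_1); intros ptd _ H; apply H. }
  destruct (filter_ex _ (filter_and _ _ HF HP)) as (ptd & H1 & H2).
  exists (scal (sign (b - a)) (Riemann_sum g ptd)); split; [|exact H1].
  apply Ds; [apply sign_ge_0; lra|apply E, H2].
Qed.

Lemma is_RInt_shift f a b c (I : V) :
  is_RInt f (a + c) (b + c) I -> is_RInt (fun s => f (s + c)) a b I.
Proof.
  intro H.
  apply (is_RInt_ext (fun s => scal 1 (f (1 * s + c)))).
  { intros s _; rewrite Rmult_1_l; exact (scal_one (f (s + c))). }
  apply is_RInt_comp_lin; now rewrite !Rmult_1_l.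
Qed.

Lemma is_RInt_sum_n (F : nat -> R -> V) (I : nat -> V) a b n :
  (forall k, (k <= n)%nat -> is_RInt (F k) a b (I k)) ->
  is_RInt (fun s => sum_n (fun k => F k s) n) a b (sum_n I n).
Proof.
  induction n as [|n IH]; intro H.
  - rewrite sum_O; apply (is_RInt_ext (F O)); [intros s _; now rewrite sum_O|now apply H].
  - rewrite sum_Sn; apply (is_RInt_ext (fun s => plus (sum_n (fun k => F k s) n) (F (S n) s)));
      [intros s _; now rewrite sum_Sn|].
    apply is_RInt_plus; [apply IH; intros; apply H; lia|apply H; lia].
Qed.

End Integrals.

Section Sums.

Context {G : AbelianMonoid}.

Lemma sum_n_shift (f : nat -> G) n : sum_n f (S n) = plus (f O) (sum_n (fun k => f (S k)) n).
Proof.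
  induction n as [|n IH].
  - now rewrite sum_Sn, !sum_O.
  - now rewrite sum_Sn, IH, (sum_Sn (fun k => f (S k))), plus_assoc.
Qed.

Lemma sum_n_zero (f : nat -> G) n : (forall k, (k <= n)%nat -> f k = zero) -> sum_n f n = zero.
Proof.
  induction n as [|n IH]; intro H.
  - rewrite sum_O; now apply H.
  - rewrite sum_Sn, IH, H, plus_zero_l; auto.
Qed.

Lemma sum_n_last (f : nat -> G) n : (forall k, (k < n)%nat -> f k = zero) -> sum_n f n = f n.
Proof.
  destruct n as [|n]; intro H; [now rewrite sum_O|].
  rewrite sum_Sn, sum_n_zero, plus_zero_l; [easy|intros; apply H; lia].
Qed.

Lemma sum_n_first (f : nat -> G) n : (forall k, (0 < k <= n)%nat -> f k = zero) -> sum_n f n = f O.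
Proof.
  destruct n as [|n]; intro H; [now rewrite sum_O|].
  rewrite sum_n_shift, (sum_n_zero (fun k => f (S k))), plus_zero_r; [easy|].
  intros; apply H; lia.
Qed.

End Sums.

Lemma sum_n_minus {V : NormedModule R_AbsRing} (f g : nat -> V) n :
  sum_n (fun k => minus (f k) (g k)) n = minus (sum_n f n) (sum_n g n).
Proof.
  induction n as [|n IH]; [now rewrite !sum_O|].
  rewrite !sum_Sn, IH; module_eq.
Qed.

Lemma sum_n_scal {V : NormedModule R_AbsRing} (r : R) (f : nat -> V) n :
  sum_n (fun k => scal r (f k)) n = scal r (sum_n f n).
Proof. exact (sum_n_scal_l r f n). Qed.

Lemma norm_sum_n_le {V : NormedModule R_AbsRing} (f : nat -> V) (g : nat -> R) n :
  (forall k, (k <= n)%nat -> norm (f k) <= g k) -> norm (sum_n f n) <= sum_n g n.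
Proof.
  induction n as [|n IH]; intro H; [rewrite !sum_O; now apply H|].
  rewrite !sum_Sn; eapply Rle_trans; [apply norm_triangle|].
  apply Rplus_le_compat; [apply IH; intros; apply H; lia|apply H; lia].
Qed.

(** * Bounded decompositions *)

Lemma half_pow_lt eps : 0 < eps -> exists N, forall n, (N <= n)%nat -> (/ 2) ^ n < eps.
Proof.
  intro He.
  destruct (pow_lt_1_zero (/ 2)) with (y := eps) as [N HN]; [rewrite Rabs_pos_eq; lra|easy|].
  exists N; intros n Hn; eapply Rle_lt_trans; [apply Rle_abs|now apply HN].
Qed.

Section Baire.

Context {X0 : CompleteNormedModule R_AbsRing}.
Local Notation X := (CompleteNormedModule.NormedModule R_AbsRing X0).

(** Baire category theorem: if no [P n] were dense in a ball, one could choose nested closed balls,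
    the next one missing [P n] at stage [n], and their common point would belong to no [P n]. *)
Lemma baire (P : nat -> X -> Prop) :
  (forall x, exists n, P n x) ->
  exists n a r, 0 < r /\ forall x, norm (minus x a) < r ->
    forall eps, 0 < eps -> exists y, P n y /\ norm (minus y x) < eps.
Proof.
  intro HP; apply NNPP; intro HN.
  (* One step of the construction; [p] packs the index, the centre and the radius. Positivity of the
     radius is a premise inside the existential so that the choice function is total. *)
  assert (H : forall p : nat * (X * R), exists q : X * R, 0 < snd (snd p) ->
    0 < snd q <= snd (snd p) / 2 /\
    forall y, norm (minus y (fst q)) <= snd q ->
      norm (minus y (fst (snd p))) <= snd (snd p) /\ ~ P (fst p) y).
  { intros (n & a & r); simpl.
    destruct (Rlt_dec 0 r) as [Hr|Hr]; [|exists (a, r); easy].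
    assert (Hx : exists x, norm (minus x a) < r /\
      exists rho, 0 < rho /\ forall y, norm (minus y x) < rho -> ~ P n y).
    { apply NNPP; intro K; apply HN; exists n, a, r; split; [easy|].
      intros x Hx eps He; apply NNPP; intro Ky; apply K; exists x; split; [easy|].
      exists eps; split; [easy|]; intros y Hy Py; apply Ky; now exists y. }
    destruct Hx as (x & Hx & rho & Hrho & Hy).
    (* The three bounds keep the closed ball off [P n], keep it inside the previous ball, and halve
       the radius. *)
    set (r' := Rmin (rho / 2) (Rmin (r - norm (minus x a)) (r / 2))).
    assert (H1 : r' <= rho / 2) by apply Rmin_l.
    assert (H2 : r' <= r - norm (minus x a)) by (eapply Rle_trans; [apply Rmin_r|apply Rmin_l]).
    assert (H3 : r' <= r / 2) by (eapply Rle_trans; [apply Rmin_r|apply Rmin_r]).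
    assert (H4 : 0 < r') by (unfold r'; repeat apply Rmin_glb_lt; lra).
    exists (x, r'); simpl; intros _; split; [lra|].
    intros y Hyx; split; [|apply Hy; lra].
    pose proof (norm_minus_triangle y x a); lra. }
  apply functional_choice in H; destruct H as [next Hnext].
  set (s := fix s n := match n with O => (zero : X, 1) | S m => next (m, s m) end).
  assert (Hpos : forall n, 0 < snd (s n)).
  { induction n as [|n IH]; [simpl; lra|].
    destruct (Hnext (n, s n) IH) as [Hq _]; apply Hq. }
  assert (Hsmall : forall n, snd (s n) <= (/ 2) ^ n).
  { induction n as [|n IH]; [simpl; lra|].
    destruct (Hnext (n, s n) (Hpos n)) as [[_ Hq] _].
    change (snd (s (S n))) with (snd (next (n, s n))); cbn [fst snd pow] in Hq |- *; lra. }
  assert (Hnest : forall k n y, norm (minus y (fst (s (k + n)%nat))) <= snd (s (k + n)%nat) ->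
    norm (minus y (fst (s n))) <= snd (s n)).
  { induction k as [|k IH]; intros n y Hy; [easy|].
    apply IH; apply (Hnext ((k + n)%nat, s (k + n)%nat) (Hpos _)), Hy. }
  assert (Hin : forall n m, (n <= m)%nat -> norm (minus (fst (s m)) (fst (s n))) <= snd (s n)).
  { intros n m Hm; apply (Hnest (m - n)%nat); replace (m - n + n)%nat with m by lia.
    rewrite norm_minus_eq0 by easy; apply Rlt_le, Hpos. }
  destruct (complete_seq (fun n => fst (s n))) as [l Hl].
  { intros eps He; destruct (half_pow_lt (eps / 2)) as [N HN']; [lra|].
    exists N; intros n m Hn Hm.
    pose proof (norm_minus_triangle (fst (s n)) (fst (s N)) (fst (s m))) as HT.
    rewrite (norm_minus_sym (fst (s N))) in HT.
    pose proof (Hin N n Hn); pose proof (Hin N m Hm); pose proof (Hsmall N).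
    specialize (HN' N (le_n N)); lra. }
  assert (Hlim : forall n, norm (minus l (fst (s n))) <= snd (s n)).
  { intro n; apply le_epsilon; intros eps He.
    destruct (Hl eps He) as [N HN'].
    specialize (HN' (N + n)%nat ltac:(lia)); pose proof (Hin n (N + n)%nat ltac:(lia)).
    rewrite norm_minus_sym in HN'.
    pose proof (norm_minus_triangle l (fst (s (N + n)%nat)) (fst (s n))); lra. }
  destruct (HP l) as [n Hn].
  apply (Hnext (n, s n) (Hpos n)) in Hn; [easy|]; apply (Hlim (S n)).
Qed.

End Baire.

Section StateSpaces.

Context {X0 : CompleteNormedModule R_AbsRing}.
Local Notation X := (CompleteNormedModule.NormedModule R_AbsRing X0).
Context (cone : X -> Prop) (HX : @abstract_state_space X0 cone).

Lemma cone_zero : cone zero.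
Proof.
  destruct (cone_generating _ HX zero) as (u & _ & Hu & _).
  replace (zero : X) with (scal 0 u) by module_eq.
  apply (cone_scal _ HX); [lra|easy].
Qed.

Lemma cone_sum_n (f : nat -> X) n : (forall k, (k <= n)%nat -> cone (f k)) -> cone (sum_n f n).
Proof.
  induction n as [|n IH]; intro H; [rewrite sum_O; now apply H|].
  rewrite sum_Sn; apply (cone_plus _ HX); [apply IH; intros; apply H; lia|apply H; lia].
Qed.

Lemma is_RInt_in_cone f a b I :
  a <= b -> (forall s, a < s < b -> cone (f s)) -> is_RInt f a b I -> cone I.
Proof.
  apply is_RInt_cone.
  - apply (cone_closed _ HX).
  - apply cone_zero.
  - apply (cone_plus _ HX).
  - apply (cone_scal _ HX).
Qed.

(** Differences of positive elements of norm at most [n] cover the space as [n] varies, so by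
    [baire] one of these sets is dense in a ball. Convexity and symmetry move the ball to the
    origin, and scaling reaches every [x]. *)
Lemma approximate_decomposition :
  exists K, 0 < K /\ forall (x : X) eps, 0 < eps -> exists u v, cone u /\ cone v /\
    norm u <= K * norm x /\ norm v <= K * norm x /\ norm (minus x (minus u v)) < eps.
Proof.
  set (P := fun (n : nat) (x : X) =>
    exists u v, cone u /\ cone v /\ norm u <= INR n /\ norm v <= INR n /\ x = minus u v).
  destruct (baire P) as (n & a & r & Hr & Ha).
  { intro x; destruct (cone_generating _ HX x) as (u & v & Hu & Hv & Hx).
    destruct (nfloor_ex (norm u + norm v)) as [n Hn].
    { pose proof (norm_ge_0 u); pose proof (norm_ge_0 v); lra. }
    exists (S n); exists u, v; rewrite S_INR.
    pose proof (norm_ge_0 u); pose proof (norm_ge_0 v); repeat split; try easy; lra. }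
  (* [x] is half the difference of [a + x] and [a - x]. Approximating both points of the ball and
     regrouping the four positive elements stays within [P n]. *)
  assert (Hsym : forall x, norm x < r -> forall eps, 0 < eps ->
    exists y, P n y /\ norm (minus x y) < eps).
  { intros x Hx eps He.
    destruct (Ha (plus a x)) with (eps := eps) as (y1 & (u1 & v1 & Cu1 & Cv1 & Nu1 & Nv1 & E1) & Hy1).
    { now replace (minus (plus a x) a) with x by module_eq. }
    { easy. }
    destruct (Ha (minus a x)) with (eps := eps) as (y2 & (u2 & v2 & Cu2 & Cv2 & Nu2 & Nv2 & E2) & Hy2).
    { replace (minus (minus a x) a) with (opp x) by module_eq; now rewrite norm_opp. }
    { easy. }
    assert (Hh : forall b c : X, cone b -> cone c -> norm b <= INR n -> norm c <= INR n ->
      cone (scal (/ 2) (plus b c)) /\ norm (scal (/ 2) (plus b c)) <= INR n).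
    { intros b c Cb Cc Nb Nc; split.
      - apply (cone_scal _ HX); [lra|now apply (cone_plus _ HX)].
      - rewrite norm_scal_eq, Rabs_pos_eq by lra; pose proof (norm_triangle b c); lra. }
    exists (scal (/ 2) (minus y1 y2)); split.
    - exists (scal (/ 2) (plus u1 v2)), (scal (/ 2) (plus v1 u2)).
      destruct (Hh u1 v2) as [H1 H2]; try easy; destruct (Hh v1 u2) as [H3 H4]; try easy.
      repeat split; try easy; rewrite E1, E2; module_eq.
    - replace (minus x (scal (/ 2) (minus y1 y2))) with
        (scal (/ 2) (minus (minus y2 (minus a x)) (minus y1 (plus a x))))
        by (module_eq_with ltac:(field)).
      rewrite norm_scal_eq, Rabs_pos_eq by lra.
      pose proof (norm_minus_le (minus y2 (minus a x)) (minus y1 (plus a x))); lra. }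
  (* Dividing [x] by [k = 2 * norm x / r] gives norm [r / 2], inside the ball; multiplying back
     turns the bound [n] into [k * n]. The [+ 1] only makes the constant positive. *)
  exists (2 * (INR n + 1) / r); split.
  { pose proof (pos_INR n); apply Rdiv_lt_0_compat; lra. }
  intros x eps He.
  destruct (Req_dec (norm x) 0) as [H0|H0].
  { exists zero, zero; rewrite norm_zero, H0, Rmult_0_r.
    apply norm_eq_zero in H0; rewrite H0.
    rewrite norm_minus_eq0 by module_eq; repeat split; try apply cone_zero; lra. }
  pose proof (norm_ge_0 x).
  set (k := 2 * norm x / r).
  assert (Hk : 0 < k) by (apply Rdiv_lt_0_compat; lra).
  destruct (Hsym (scal (/ k) x)) with (eps := eps / k) as (y & (u & v & Cu & Cv & Nu & Nv & E) & Hy).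
  { rewrite norm_scal_eq, Rabs_pos_eq by (apply Rlt_le, Rinv_0_lt_compat, Hk).
    unfold k; replace (/ (2 * norm x / r) * norm x) with (r / 2) by (field; split; lra); lra. }
  { now apply Rdiv_lt_0_compat. }
  assert (HK : forall w : X, norm w <= INR n -> norm (scal k w) <= 2 * (INR n + 1) / r * norm x).
  { intros w Hw; rewrite norm_scal_eq, Rabs_pos_eq by lra.
    replace (2 * (INR n + 1) / r * norm x) with (k * (INR n + 1)) by (unfold k; field; lra).
    apply Rmult_le_compat_l; lra. }
  exists (scal k u), (scal k v).
  split; [apply (cone_scal _ HX); [lra|easy]|].
  split; [apply (cone_scal _ HX); [lra|easy]|].
  split; [now apply HK|]; split; [now apply HK|].
  rewrite (norm_of_scal k _ (minus (scal (/ k) x) y)), Rabs_pos_eq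
    by (lra || (rewrite E; module_eq_with ltac:(field; lra))).
  replace eps with (k * (eps / k)) by (field; lra).
  now apply Rmult_lt_compat_l.
Qed.

Lemma geometric_sum (f : nat -> X) (K : R) :
  (forall k, norm (f k) <= K * (/ 2) ^ k) ->
  (forall k, cone (f k)) ->
  exists l, cone l /\ norm l <= 2 * K /\
    forall eps, 0 < eps -> exists N, forall n, (N <= n)%nat -> norm (minus (sum_n f n) l) < eps.
Proof.
  intros Hf Hc.
  assert (HK : 0 <= K) by (pose proof (Hf O) as H0; pose proof (norm_ge_0 (f O)); simpl in H0; lra).
  (* The bound is the geometric sum from [n + 1] to [n + k] in closed form, so the induction on [k]
     closes exactly. *)
  assert (Hd : forall k n, norm (minus (sum_n f (n + k)) (sum_n f n)) <= K * ((/ 2) ^ n - (/ 2) ^ (n + k))).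
  { induction k as [|k IH]; intro n.
    - rewrite Nat.add_0_r; rewrite norm_minus_eq0 by easy; lra.
    - rewrite Nat.add_succ_r, sum_Sn.
      replace (minus (plus (sum_n f (n + k)) (f (S (n + k)))) (sum_n f n))
        with (plus (minus (sum_n f (n + k)) (sum_n f n)) (f (S (n + k)))) by module_eq.
      eapply Rle_trans; [apply norm_triangle|].
      specialize (IH n); pose proof (Hf (S (n + k))) as H1; simpl in H1 |- *; lra. }
  destruct (complete_seq (sum_n f)) as [l Hl].
  { intros eps He; destruct (half_pow_lt (eps / (2 * (K + 1)))) as [N HN].
    { apply Rdiv_lt_0_compat; lra. }
    specialize (HN N (le_n N)).
    assert (HKN : (K + 1) * (/ 2) ^ N < eps / 2).
    { replace (eps / 2) with ((K + 1) * (eps / (2 * (K + 1)))) by (field; lra).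
      apply Rmult_lt_compat_l; lra. }
    assert (HN2 : forall n, (N <= n)%nat -> norm (minus (sum_n f n) (sum_n f N)) < eps / 2).
    { intros n Hn; pose proof (Hd (n - N)%nat N) as H1; replace (N + (n - N))%nat with n in H1 by lia.
      pose proof (pow_lt (/ 2) n ltac:(lra)); pose proof (pow_lt (/ 2) N ltac:(lra)); nra. }
    exists N; intros n m Hn Hm.
    pose proof (norm_minus_triangle (sum_n f n) (sum_n f N) (sum_n f m)) as HT.
    rewrite (norm_minus_sym (sum_n f N)) in HT.
    pose proof (HN2 n Hn); pose proof (HN2 m Hm); lra. }
  exists l; split; [|split; [|exact Hl]].
  - apply (closed_eps cone (cone_closed _ HX)); intros eps He.
    destruct (Hl eps He) as [N HN]; exists (sum_n f N); split; [now apply cone_sum_n|now apply HN].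
  - apply le_epsilon; intros eps He; destruct (Hl eps He) as [N HN]; specialize (HN N (le_n N)).
    pose proof (Hd N O) as H1; simpl in H1; rewrite sum_O in H1.
    pose proof (norm_le_minus l (sum_n f N)) as H2; rewrite (norm_minus_sym l) in H2.
    pose proof (norm_le_minus (sum_n f N) (f O)); pose proof (Hf O) as H3; simpl in H3.
    pose proof (pow_lt (/ 2) N ltac:(lra)); nra.
Qed.

(* Klee-Ando: the error of an approximate decomposition is decomposed again, with
   geometrically decaying norms. *)
Lemma bounded_decomposition :
  exists C, 0 < C /\ forall x : X, exists u v, cone u /\ cone v /\ x = minus u v /\
    norm u <= C * norm x /\ norm v <= C * norm x.
Proof.
  destruct approximate_decomposition as (K & HK & H).
  exists (2 * K); split; [lra|]; intro x.
  (* The tolerances below are proportional to [norm x] and must be positive. *)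
  destruct (Req_dec (norm x) 0) as [H0|H0].
  { exists zero, zero; rewrite norm_zero, H0, Rmult_0_r.
    apply norm_eq_zero in H0; rewrite H0.
    repeat split; try apply cone_zero; try lra; module_eq. }
  pose proof (norm_ge_0 x).
  assert (Hc : forall p : nat * X, exists q : X * X, cone (fst q) /\ cone (snd q) /\
    norm (fst q) <= K * norm (snd p) /\ norm (snd q) <= K * norm (snd p) /\
    norm (minus (snd p) (minus (fst q) (snd q))) < norm x * (/ 2) ^ (S (fst p))).
  { intros (n & y); destruct (H y (norm x * (/ 2) ^ (S n))) as (u & v & Huv).
    { apply Rmult_lt_0_compat; [lra|apply pow_lt; lra]. }
    exists (u, v); apply Huv. }
  apply functional_choice in Hc; destruct Hc as [dec Hdec].
  (* [rest n] is the error left after [n] approximate decompositions; its norm is at most [norm x]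
     times 2^(-n), which makes both series of positive parts geometric and explains the constant
     [2 * K]. *)
  set (rest := fix rest n := match n with
    | O => x
    | S m => minus (rest m) (minus (fst (dec (m, rest m))) (snd (dec (m, rest m)))) end).
  assert (Hrest : forall n, norm (rest n) <= norm x * (/ 2) ^ n).
  { intros [|n]; [simpl; lra|]; apply Rlt_le, (Hdec (n, rest n)). }
  assert (Hb : forall n, K * norm (rest n) <= (K * norm x) * (/ 2) ^ n).
  { intro n; rewrite Rmult_assoc; apply Rmult_le_compat_l; [lra|apply Hrest]. }
  destruct (geometric_sum (fun n => fst (dec (n, rest n))) (K * norm x)) as (u & Cu & Nu & Lu).
  { intro n; eapply Rle_trans; [apply (Hdec (n, rest n))|apply Hb]. }
  { intro n; apply (Hdec (n, rest n)). }
  destruct (geometric_sum (fun n => snd (dec (n, rest n))) (K * norm x)) as (v & Cv & Nv & Lv).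
  { intro n; eapply Rle_trans; [apply (Hdec (n, rest n))|apply Hb]. }
  { intro n; apply (Hdec (n, rest n)). }
  assert (E : forall n, x = plus (rest (S n)) (minus (sum_n (fun n => fst (dec (n, rest n))) n)
    (sum_n (fun n => snd (dec (n, rest n))) n))).
  { induction n as [|n IH].
    - rewrite !sum_O; simpl; module_eq.
    - rewrite !sum_Sn; etransitivity; [exact IH|].
      change (rest (S (S n))) with (minus (rest (S n))
        (minus (fst (dec (S n, rest (S n)))) (snd (dec (S n, rest (S n)))))).
      module_eq. }
  exists u, v; repeat split; try easy; try lra.
  apply eq_of_norm_lt; intros eps He.
  destruct (Lu (eps / 3) ltac:(lra)) as [N1 HN1]; destruct (Lv (eps / 3) ltac:(lra)) as [N2 HN2].
  destruct (half_pow_lt (eps / (3 * norm x))) as [N3 HN3]; [apply Rdiv_lt_0_compat; lra|].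
  set (n := (N1 + N2 + N3)%nat).
  specialize (HN1 n ltac:(lia)); specialize (HN2 n ltac:(lia)); specialize (HN3 (S n) ltac:(lia)).
  assert (H4 : norm (rest (S n)) < eps / 3).
  { eapply Rle_lt_trans; [apply Hrest|].
    replace (eps / 3) with (norm x * (eps / (3 * norm x))) by (field; lra).
    apply Rmult_lt_compat_l; lra. }
  rewrite (E n) at 1.
  set (su := sum_n (fun n => fst (dec (n, rest n))) n) in *.
  set (sv := sum_n (fun n => snd (dec (n, rest n))) n) in *.
  replace (minus (plus (rest (S n)) (minus su sv)) (minus u v))
    with (plus (rest (S n)) (minus (minus su u) (minus sv v))) by module_eq.
  eapply Rle_lt_trans; [apply norm_triangle|].
  pose proof (norm_minus_le (minus su u) (minus sv v)); lra.
Qed.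

End StateSpaces.

(** * Semigroups and generators *)

Section OrbitIntegrals.

Context {X0 : CompleteNormedModule R_AbsRing}.
Local Notation X := (CompleteNormedModule.NormedModule R_AbsRing X0).

(** A right modulus that is uniform in [t] also controls increments to the left. Freezing [f] at its
    value at [0] for negative times therefore gives a function continuous on the whole line. *)
Lemma ex_RInt_modulus (f : R -> X) (e : R -> R) a b :
  (forall t h, 0 <= t -> 0 < h -> norm (minus (f (t + h)) (f t)) <= e h) ->
  rlim e 0 -> 0 <= a <= b -> ex_RInt f a b.
Proof.
  intros Hf He Hab.
  apply (ex_RInt_ext (fun s => f (Rmax 0 s))).
  { intros s Hs; rewrite Rmin_left in Hs by lra; rewrite Rmax_right by lra; easy. }
  apply (ex_RInt_continuous (V := X0)); intros z _.
  apply (proj2 (filterlim_locally_ball_norm (U := X) (fun s => f (Rmax 0 s)) (f (Rmax 0 z)))).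
  intro eps.
  destruct (proj1 (rlim_eps (V := R_NormedModule) e 0) He eps (cond_pos eps)) as (d & Hd & H).
  assert (H' : forall t h, 0 <= t -> 0 < h < d -> norm (minus (f (t + h)) (f t)) < eps).
  { intros t h Ht Hh; eapply Rle_lt_trans; [apply Hf; lra|].
    specialize (H h Hh); change (Rabs (e h + - 0) < eps) in H; apply Rabs_def2 in H; lra. }
  exists (mkposreal d Hd); intros s Hs.
  change (Rabs (s + - z) < d) in Hs; apply Rabs_def2 in Hs.
  change (norm (minus (f (Rmax 0 s)) (f (Rmax 0 z))) < eps).
  assert (Hr : - d < Rmax 0 s - Rmax 0 z < d).
  { unfold Rmax; destruct (Rle_dec 0 s); destruct (Rle_dec 0 z); lra. }
  pose proof (Rmax_l 0 s); pose proof (Rmax_l 0 z).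
  destruct (Rtotal_order (Rmax 0 s) (Rmax 0 z)) as [Hlt|[->|Hlt]].
  - rewrite norm_minus_sym; replace (Rmax 0 z) with (Rmax 0 s + (Rmax 0 z - Rmax 0 s)) by ring.
    apply H'; lra.
  - rewrite norm_minus_eq0 by easy; apply cond_pos.
  - replace (Rmax 0 s) with (Rmax 0 z + (Rmax 0 s - Rmax 0 z)) by ring.
    apply H'; lra.
Qed.

Definition orbit_int (T : R -> X -> X) (t : R) (u : X) : X := RInt (V := X0) (fun s => T s u) 0 t.

Lemma orbit_int_unique (T : R -> X -> X) t u (I : X) :
  is_RInt (fun s => T s u) 0 t I -> orbit_int T t u = I.
Proof. apply (is_RInt_unique (V := X0)). Qed.

Lemma RInt_eq (f : R -> X) a b (I I' : X) : is_RInt f a b I -> is_RInt f a b I' -> I = I'.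
Proof.
  intros H H'; transitivity (RInt (V := X0) f a b).
  - symmetry; exact (is_RInt_unique (V := X0) f a b I H).
  - exact (is_RInt_unique (V := X0) f a b I' H').
Qed.

(* The lower triangular Toeplitz matrices [(F (i - j) t)] form a C0-semigroup of
   bounded operators on every finite power of the space. *)
Record toeplitz_semigroup (M : R) (F : nat -> R -> X -> X) : Prop := {
  ts_pos : 0 <= M;
  ts_linear : forall n t, 0 <= t -> is_linear (F n t);
  ts_bound : forall n t u, 0 <= t -> norm (F n t u) <= M * norm u;
  ts_plus : forall n t s u, 0 <= t -> 0 <= s ->
    F n (t + s) u = sum_n (fun k => F (n - k)%nat t (F k s u)) n;
  ts_cont : forall n u, rlim (fun h => F n h u) (F n 0 u)
}.

Section Toeplitz.

Context (M : R) (F : nat -> R -> X -> X) (HF : toeplitz_semigroup M F).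

Definition orbit_modulus n u h : R :=
  sum_n (fun k => M * norm (minus (F k h u) (F k 0 u))) n.

Lemma orbit_modulus_lim n u : rlim (orbit_modulus n u) 0.
Proof.
  assert (H : rlim (orbit_modulus n u) (sum_n (fun _ => M * 0) n)).
  { apply (rlim_sum_n (V := R_NormedModule) (fun k h => M * norm (minus (F k h u) (F k 0 u)))).
    intros k _; apply (rlim_scal (V := R_NormedModule)).
    apply rlim_norm, (ts_cont _ _ HF). }
  now rewrite sum_n_const, Rmult_0_r, Rmult_0_r in H.
Qed.

(** With [t] as the outer time in [ts_plus], the increment at [t] is the image under bounded
    operators of the increments at [0]; hence a modulus independent of [t]. *)
Lemma orbit_modulus_le n u t h : 0 <= t -> 0 <= h ->
  norm (minus (F n (t + h) u) (F n t u)) <= orbit_modulus n u h.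
Proof.
  intros Ht Hh; replace (F n t u) with (F n (t + 0) u) by (f_equal; ring).
  rewrite !(ts_plus _ _ HF) by lra.
  rewrite <- sum_n_minus; apply norm_sum_n_le; intros k _.
  rewrite <- (linear_minus (F (n - k)%nat t)) by (apply (ts_linear _ _ HF), Ht).
  now apply (ts_bound _ _ HF).
Qed.

Lemma ex_RInt_orbit n u a b : 0 <= a <= b -> ex_RInt (fun s => F n s u) a b.
Proof.
  apply (ex_RInt_modulus _ (orbit_modulus n u)).
  - intros t h Ht Hh; apply orbit_modulus_le; lra.
  - apply orbit_modulus_lim.
Qed.

Lemma is_RInt_orbit n t u : 0 <= t -> is_RInt (fun s => F n s u) 0 t (orbit_int (F n) t u).
Proof. intro Ht; apply (RInt_correct (V := X0)), ex_RInt_orbit; lra. Qed.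

Lemma orbit_int_bound n t u : 0 <= t -> norm (orbit_int (F n) t u) <= t * (M * norm u).
Proof.
  intro Ht; replace t with (t - 0) at 2 by ring.
  apply (norm_RInt_le_const (fun s => F n s u)); [easy| |now apply is_RInt_orbit].
  intros s Hs; apply (ts_bound _ _ HF); lra.
Qed.

Lemma orbit_int_linear n t : 0 <= t -> is_linear (orbit_int (F n) t).
Proof.
  intro Ht; split.
  - intros x y; apply orbit_int_unique.
    eapply is_RInt_ext; [|apply is_RInt_plus; apply is_RInt_orbit, Ht].
    intros s Hs; rewrite Rmin_left in Hs by easy; symmetry; apply linear_plus, (ts_linear _ _ HF); lra.
  - intros k x; apply orbit_int_unique.
    eapply is_RInt_ext; [|apply is_RInt_scal; apply is_RInt_orbit, Ht].
    intros s Hs; rewrite Rmin_left in Hs by easy; symmetry.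
    apply (linear_scal (F n s)), (ts_linear _ _ HF); lra.
  - exists (t * M + 1); pose proof (ts_pos _ _ HF); split.
    + pose proof (Rmult_le_pos t M Ht H); lra.
    + intro x; eapply Rle_trans; [now apply orbit_int_bound|].
      pose proof (norm_ge_0 x); nra.
Qed.

Lemma orbit_int_0 n u : orbit_int (F n) 0 u = zero.
Proof. apply orbit_int_unique, is_RInt_point. Qed.

Lemma is_RInt_orbit_from n t h u : 0 <= t -> 0 <= h ->
  is_RInt (fun s => F n s u) t (t + h) (minus (orbit_int (F n) (t + h) u) (orbit_int (F n) t u)).
Proof.
  intros Ht Hh.
  destruct (ex_RInt_orbit n u t (t + h)) as [I HI]; [lra|].
  replace (minus (orbit_int (F n) (t + h) u) (orbit_int (F n) t u)) with I; [easy|].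
  rewrite (orbit_int_unique (F n) (t + h) u (plus (orbit_int (F n) t u) I)); [module_eq|].
  apply (is_RInt_Chasles _ _ t); [now apply is_RInt_orbit|easy].
Qed.

Lemma is_RInt_orbit_shift n t h u : 0 <= t -> 0 <= h ->
  is_RInt (fun s => F n (s + h) u) 0 t (minus (orbit_int (F n) (t + h) u) (orbit_int (F n) h u)).
Proof.
  intros Ht Hh; apply (is_RInt_shift (fun s => F n s u)).
  rewrite Rplus_0_l, (Rplus_comm t h); now apply is_RInt_orbit_from.
Qed.

(** Here [h] is the outer time, so the operators leave the integral and difference quotients act on
    the integral itself; in [orbit_int_shift_r] it is the inner time, and they act on the initial
    value [u]. *)
Lemma orbit_int_shift_l n t h u : 0 <= t -> 0 <= h ->
  minus (orbit_int (F n) (t + h) u) (orbit_int (F n) h u) =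
  sum_n (fun k => F (n - k)%nat h (orbit_int (F k) t u)) n.
Proof.
  intros Ht Hh; eapply RInt_eq; [now apply is_RInt_orbit_shift|].
  apply (is_RInt_ext (fun s => sum_n (fun k => F (n - k)%nat h (F k s u)) n)).
  { intros s Hs; rewrite Rmin_left in Hs by easy.
    rewrite (Rplus_comm s h), (ts_plus _ _ HF); [easy|lra|lra]. }
  apply (is_RInt_sum_n (fun k s => F (n - k)%nat h (F k s u))); intros k _.
  apply (is_RInt_linear (F (n - k)%nat h)); [now apply (ts_linear _ _ HF)|].
  now apply is_RInt_orbit.
Qed.

Lemma orbit_int_shift_r n t h u : 0 <= t -> 0 <= h ->
  minus (orbit_int (F n) (t + h) u) (orbit_int (F n) h u) =
  sum_n (fun k => orbit_int (F (n - k)%nat) t (F k h u)) n.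
Proof.
  intros Ht Hh; eapply RInt_eq; [now apply is_RInt_orbit_shift|].
  apply (is_RInt_ext (fun s => sum_n (fun k => F (n - k)%nat s (F k h u)) n)).
  { intros s Hs; rewrite Rmin_left in Hs by easy.
    rewrite (ts_plus _ _ HF); [easy|lra|lra]. }
  apply (is_RInt_sum_n (fun k s => F (n - k)%nat s (F k h u))); intros k _.
  now apply is_RInt_orbit.
Qed.

Lemma orbit_int_derivative n t u : 0 <= t ->
  rlim (fun h => scal (/ h) (minus (orbit_int (F n) (t + h) u) (orbit_int (F n) t u))) (F n t u).
Proof.
  intro Ht; apply rlim_eps; intros eps He.
  destruct (proj1 (rlim_eps (V := R_NormedModule) _ _) (orbit_modulus_lim n u) (eps / 2))
    as (d & Hd & H); [lra|].
  exists d; split; [easy|]; intros h Hh.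
  rewrite (norm_of_scal (/ h) _ (minus (minus (orbit_int (F n) (t + h) u) (orbit_int (F n) t u))
    (scal h (F n t u)))) by (module_eq_with ltac:(field; lra)).
  rewrite Rabs_pos_eq by (apply Rlt_le, Rinv_0_lt_compat; lra).
  apply Rmult_lt_reg_l with h; [lra|]; rewrite <- Rmult_assoc, Rinv_r, Rmult_1_l by lra.
  apply Rle_lt_trans with (h * (eps / 2)); [|nra].
  replace (h * (eps / 2)) with ((t + h - t) * (eps / 2)) by ring.
  apply (norm_RInt_le_const (fun s => minus (F n s u) (F n t u)) t (t + h)); [lra| |].
  - intros s Hs; destruct (Req_dec s t) as [->|Hne].
    { rewrite norm_minus_eq0 by easy; lra. }
    replace s with (t + (s - t)) by ring.
    eapply Rle_trans; [apply orbit_modulus_le; lra|].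
    specialize (H (s - t) ltac:(lra)).
    change (Rabs (orbit_modulus n u (s - t) + - 0) < eps / 2) in H; apply Rabs_def2 in H; lra.
  - apply is_RInt_minus; [apply is_RInt_orbit_from; lra|].
    replace (scal h (F n t u)) with (scal (t + h - t) (F n t u)) by (f_equal; ring).
    apply is_RInt_const.
Qed.

(** The expression regroups into the difference quotients of the integral at [t] and at [0]. *)
Lemma orbit_int_quotient n t u : 0 <= t ->
  rlim (fun h => scal (/ h) (minus (minus (orbit_int (F n) (t + h) u) (orbit_int (F n) h u))
     (orbit_int (F n) t u))) (minus (F n t u) (F n 0 u)).
Proof.
  intro Ht.
  apply (rlim_ext (fun h => minus
    (scal (/ h) (minus (orbit_int (F n) (t + h) u) (orbit_int (F n) t u)))
    (scal (/ h) (minus (orbit_int (F n) (0 + h) u) (orbit_int (F n) 0 u))))).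
  { intros h Hh; rewrite orbit_int_0, Rplus_0_l; module_eq. }
  apply rlim_minus; apply orbit_int_derivative; lra.
Qed.

End Toeplitz.

End OrbitIntegrals.

Lemma maps_eq {Y Z : Type} (f : pfun Y Z) u u' w w' : maps f u w -> u = u' -> w = w' -> maps f u' w'.
Proof. now intros H <- <-. Qed.

Section Generators.

Context {X0 : CompleteNormedModule R_AbsRing}.
Local Notation X := (CompleteNormedModule.NormedModule R_AbsRing X0).
Context (M : R) (T : R -> X -> X) (A : pfun X X).
Context (HT : @C0_semigroup X0 T) (HM : 0 <= M)
  (Hbound : forall t (u : X), 0 <= t -> norm (T t u) <= M * norm u)
  (HA : @generator X0 T A).

Lemma C0_linear t : 0 <= t -> is_linear (T t).
Proof. apply (sg_bounded _ HT). Qed.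

Lemma C0_rlim u : rlim (fun h => T h u) u.
Proof. apply (sg_continuous _ HT). Qed.

Lemma generatorP (u w : X) : maps A u w <-> rlim (fun h => scal (/ h) (minus (T h u) u)) w.
Proof. exact (HA u w). Qed.

Lemma maps_self (u : X) : dom A u -> maps A u (A u).
Proof. now split. Qed.

(** A single semigroup is the family with only a diagonal entry, so every statement about Toeplitz
    families applies to it at index [O]. *)
Lemma C0_toeplitz :
  toeplitz_semigroup M (fun n => match n with O => T | S _ => fun _ _ => zero end).
Proof.
  split.
  - easy.
  - intros [|n] t Ht; [now apply C0_linear|apply is_linear_zero].
  - intros [|n] t u Ht; [now apply Hbound|].
    rewrite norm_zero; apply Rmult_le_pos; [easy|apply norm_ge_0].
  - intros [|n] t s u Ht Hs; [rewrite sum_O; now apply (sg_plus _ HT)|].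
    symmetry; rewrite sum_n_last.
    + replace (S n - S n)%nat with O by lia; apply (linear_zero (T t)), C0_linear, Ht.
    + intros k Hk; destruct (S n - k)%nat eqn:E; [lia|easy].
  - intros [|n] u; [|apply rlim_const].
    rewrite (sg_zero _ HT); apply C0_rlim.
Qed.

Local Notation J := (orbit_int T).

Lemma C0_is_RInt t u : 0 <= t -> is_RInt (fun s => T s u) 0 t (J t u).
Proof. exact (is_RInt_orbit _ _ C0_toeplitz O t u). Qed.

Lemma C0_int_linear t : 0 <= t -> is_linear (J t).
Proof. exact (orbit_int_linear _ _ C0_toeplitz O t). Qed.

Lemma generator_plus u v y z : maps A u y -> maps A v z -> maps A (plus u v) (plus y z).
Proof.
  rewrite !generatorP; intros Hu Hv.
  eapply rlim_ext; [|exact (rlim_plus _ _ _ _ Hu Hv)].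
  intros h Hh; cbv beta; rewrite (linear_plus (T h)) by (apply C0_linear; lra); module_eq.
Qed.

Lemma generator_scal r u y : maps A u y -> maps A (scal r u) (scal r y).
Proof.
  rewrite !generatorP; intros Hu.
  eapply rlim_ext; [|exact (rlim_scal r _ _ Hu)].
  intros h Hh; cbv beta.
  rewrite (linear_scal (T h) (C0_linear h ltac:(lra)) r u); module_eq.
Qed.

Lemma generator_minus u v y z : maps A u y -> maps A v z -> maps A (minus u v) (minus y z).
Proof.
  intros Hu Hv; replace (minus u v) with (plus u (scal (-1) v)) by module_eq.
  replace (minus y z) with (plus y (scal (-1) z)) by module_eq.
  now apply generator_plus, generator_scal.
Qed.

Lemma generator_orbit_int t u : 0 <= t -> maps A (J t u) (minus (T t u) u).
Proof.
  intro Ht; apply generatorP.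
  pose proof (orbit_int_quotient _ _ C0_toeplitz O t u Ht) as H.
  cbv beta iota in H; rewrite (sg_zero _ HT) in H.
  eapply rlim_ext; [|exact H]; intros h Hh; cbv beta.
  pose proof (orbit_int_shift_l _ _ C0_toeplitz O t h u Ht ltac:(lra)) as E.
  rewrite sum_O in E; cbv beta iota in E; rewrite E; easy.
Qed.

Lemma orbit_int_generator t u w : 0 <= t -> maps A u w -> minus (T t u) u = J t w.
Proof.
  intros Ht Hu; apply generatorP in Hu.
  pose proof (orbit_int_quotient _ _ C0_toeplitz O t u Ht) as H.
  cbv beta iota in H; rewrite (sg_zero _ HT) in H.
  eapply rlim_unique; [exact H|].
  eapply rlim_ext; [|exact (rlim_linear (J t) _ _ (C0_int_linear t Ht) Hu)].
  intros h Hh; cbv beta.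
  pose proof (orbit_int_shift_r _ _ C0_toeplitz O t h u Ht ltac:(lra)) as E.
  rewrite sum_O in E; cbv beta iota in E; rewrite E.
  exact (linear_quotient (J t) (C0_int_linear t Ht) (/ h) (T h u) u).
Qed.

Lemma orbit_int_mean u : rlim (fun h => scal (/ h) (J h u)) u.
Proof.
  pose proof (orbit_int_derivative _ _ C0_toeplitz O 0 u ltac:(lra)) as H.
  cbv beta iota in H; rewrite (sg_zero _ HT) in H.
  eapply rlim_ext; [|exact H]; intros h Hh; cbv beta.
  rewrite Rplus_0_l.
  replace (orbit_int T 0 u) with (zero : X); [f_equal; module_eq|].
  symmetry; apply orbit_int_unique, is_RInt_point.
Qed.

(** The integrated relation [T h x - x = J h y] involves only bounded operators and passes to the
    limit; dividing it by [h] then recovers the generator. *)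
Lemma generator_closed u w :
  (forall eps, 0 < eps -> exists x y, maps A x y /\ norm (minus x u) < eps /\ norm (minus y w) < eps) ->
  maps A u w.
Proof.
  intro H; apply generatorP.
  eapply rlim_ext; [|exact (orbit_int_mean w)].
  intros h Hh; cbv beta; f_equal.
  apply eq_of_norm_lt; intros eps He.
  destruct (linear_norm (J h) (C0_int_linear h ltac:(lra))) as (K & HK & HJ).
  (* The three error terms add up to at most [(K + M + 1) * e], which is [eps / 2]. *)
  set (e := eps / (2 * (K + M + 1))).
  assert (He' : 0 < e) by (apply Rdiv_lt_0_compat; lra).
  destruct (H e He') as (x & y & Hxy & Hx & Hy).
  pose proof (orbit_int_generator h x y ltac:(lra) Hxy) as E.
  assert (Hn : norm (minus (J h w) (minus (T h u) u)) <=
    norm (J h (minus y w)) + (norm (T h (minus x u)) + norm (minus x u))).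
  { eapply Rle_trans; [|apply Rplus_le_compat_l, (norm_minus_le (T h (minus x u)) (minus x u))].
    rewrite <- (norm_opp (J h (minus y w))); apply norm_of_plus.
    rewrite (linear_minus (J h)) by (apply C0_int_linear; lra).
    rewrite (linear_minus (T h)) by (apply C0_linear; lra).
    rewrite <- E; module_eq. }
  pose proof (HJ (minus y w)); pose proof (Hbound h (minus x u) ltac:(lra)).
  assert (HK' : K * norm (minus y w) <= K * e) by (apply Rmult_le_compat_l; lra).
  assert (HM' : M * norm (minus x u) <= M * e) by (apply Rmult_le_compat_l; lra).
  assert (Ee : (K + M + 1) * e = eps / 2) by (unfold e; field; lra).
  lra.
Qed.

Lemma generator_orbit t u w : 0 <= t -> maps A u w -> maps A (T t u) (T t w).
Proof.
  intros Ht; rewrite !generatorP; intro Hu.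
  eapply rlim_ext; [|exact (rlim_linear (T t) _ _ (C0_linear t Ht) Hu)].
  intros h Hh; cbv beta.
  etransitivity; [exact (linear_quotient (T t) (C0_linear t Ht) (/ h) (T h u) u)|].
  rewrite <- !(sg_plus _ HT) by lra; now rewrite Rplus_comm.
Qed.

(** Hille's theorem on closed operators under the integral sign. The bounded operators [T h] and
    [J h] do commute with the integral, whence [T h I - I = J h I']. *)
Lemma is_RInt_generator f a b (I I' : X) : a <= b ->
  (forall s, a < s < b -> dom A (f s)) -> is_RInt f a b I ->
  is_RInt (fun s => A (f s)) a b I' -> maps A I I'.
Proof.
  intros Hab Hd HI HI'; apply generatorP.
  eapply rlim_ext; [|exact (orbit_int_mean I')].
  intros h Hh; cbv beta; f_equal.
  apply (RInt_eq (fun s => J h (A (f s))) a b).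
  - apply (is_RInt_linear (J h)); [apply C0_int_linear; lra|easy].
  - apply (is_RInt_ext (fun s => minus (T h (f s)) (f s))).
    + intros s Hs; rewrite Rmin_left, Rmax_right in Hs by easy.
      apply orbit_int_generator; [lra|apply maps_self, Hd, Hs].
    + apply is_RInt_minus; [|easy].
      apply (is_RInt_linear (T h)); [apply C0_linear; lra|easy].
Qed.

End Generators.

(** * Exponential rescaling, the resolvent at 1 and the relative bound of the perturbation *)

Lemma rlim_scal_fun {V : NormedModule R_AbsRing} (k : R -> R) (c : R) (f : R -> V) (l : V) :
  rlim k c -> rlim f l -> rlim (fun h => scal (k h) (f h)) (scal c l).
Proof.
  intros Hk Hf.
  eapply filterlim_comp_2; [exact Hk|exact Hf|exact (filterlim_scal (K := R_AbsRing) c l)].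
Qed.

Lemma rlim_exp_quotient c : rlim (fun h => / h * (exp (c * h) - 1)) c.
Proof.
  apply (rlim_eps (V := R_NormedModule)); intros eps He.
  assert (D : is_derive (fun x => exp (c * x)) 0 c).
  { auto_derive; [easy|]; rewrite Rmult_0_r, exp_0; ring. }
  apply is_derive_Reals in D; destruct (D eps He) as [d Hd].
  exists d; split; [apply cond_pos|]; intros h Hh.
  specialize (Hd h ltac:(lra) ltac:(rewrite Rabs_pos_eq; lra)).
  rewrite Rplus_0_l, Rmult_0_r, exp_0 in Hd.
  change (Rabs (/ h * (exp (c * h) - 1) + - c) < eps).
  replace (/ h * (exp (c * h) - 1) + - c) with ((exp (c * h) - 1) / h - c); [easy|].
  unfold Rdiv; ring.
Qed.

Lemma rlim_exp c : rlim (fun h => exp (c * h)) 1.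
Proof.
  apply (rlim_ext (V := R_NormedModule) (fun h => 1 + h * (/ h * (exp (c * h) - 1)))).
  { intros h Hh; change (1 + h * (/ h * (exp (c * h) - 1)) = exp (c * h)); field; lra. }
  assert (H : rlim (fun h => 1 + h * (/ h * (exp (c * h) - 1))) (1 + 0 * c)).
  { apply (rlim_plus (V := R_NormedModule) (fun _ => 1)); [apply rlim_const|].
    apply (rlim_scal_fun (V := R_NormedModule)); [apply rlim_id|apply rlim_exp_quotient]. }
  now rewrite Rmult_0_l, Rplus_0_r in H.
Qed.

Lemma rlim_exp_scal {V : NormedModule R_AbsRing} c (f : R -> V) (u w : V) :
  rlim (fun h => scal (/ h) (minus (f h) u)) w ->
  rlim (fun h => scal (/ h) (minus (scal (exp (c * h)) (f h)) u)) (plus w (scal c u)).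
Proof.
  intro H.
  apply (rlim_ext (fun h => plus (scal (exp (c * h)) (scal (/ h) (minus (f h) u)))
    (scal (/ h * (exp (c * h) - 1)) u))).
  { intros h Hh; module_eq. }
  replace w with (scal 1 w) at 1 by module_eq.
  apply rlim_plus.
  - apply rlim_scal_fun; [apply rlim_exp|easy].
  - apply (rlim_scal_fun _ _ (fun _ => u)); [apply rlim_exp_quotient|apply rlim_const].
Qed.

Lemma exp_neg_small c eps : 0 <= c -> 0 < eps -> exists N, forall n, (N <= n)%nat -> c * exp (- INR n) < eps.
Proof.
  intros Hc He; destruct (nfloor_ex (c / eps)) as [N HN].
  { apply Rmult_le_pos; [easy|apply Rlt_le, Rinv_0_lt_compat, He]. }
  exists N; intros n Hn; apply le_INR in Hn.
  assert (H1 : c < eps * (1 + INR n)).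
  { replace c with (eps * (c / eps)) by (field; lra); apply Rmult_lt_compat_l; lra. }
  pose proof (pos_INR n).
  assert (H2 : 1 + INR n <= exp (INR n)).
  { destruct (Req_dec (INR n) 0) as [E|E]; [rewrite E, exp_0; lra|apply Rlt_le, exp_ineq1; easy]. }
  rewrite exp_Ropp; apply Rmult_lt_reg_r with (exp (INR n)); [apply exp_pos|].
  rewrite Rmult_assoc, Rinv_l, Rmult_1_r by (pose proof (exp_pos (INR n)); lra).
  eapply Rlt_le_trans; [exact H1|]; apply Rmult_le_compat_l; lra.
Qed.

Section Perturbation.

Context {X0 : CompleteNormedModule R_AbsRing}.
Local Notation X := (CompleteNormedModule.NormedModule R_AbsRing X0).
Context (cone : X -> Prop) (Psi : X -> R)
  (HX : @abstract_state_space X0 cone) (HPsi : @norm_functional X0 cone Psi).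
Context (C : R) (HC : 0 < C)
  (Hdec : forall x : X, exists u v, cone u /\ cone v /\ x = minus u v /\
    norm u <= C * norm x /\ norm v <= C * norm x).

Lemma Psi_linear : is_linear Psi.
Proof. apply HPsi. Qed.

Lemma Psi_norm u : cone u -> Psi u = norm u.
Proof. apply HPsi. Qed.

Lemma Psi_ge0 u : cone u -> 0 <= Psi u.
Proof. intro Hu; rewrite Psi_norm by easy; apply norm_ge_0. Qed.

Lemma Psi_plus u v : Psi (plus u v) = Psi u + Psi v.
Proof. exact (linear_plus Psi Psi_linear u v). Qed.

Lemma Psi_minus u v : Psi (minus u v) = Psi u - Psi v.
Proof. exact (linear_minus Psi u v Psi_linear). Qed.

Lemma cone_add u v : cone u -> cone v -> cone (plus u v).
Proof. apply (cone_plus _ HX). Qed.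

Lemma cone_mul r u : 0 <= r -> cone u -> cone (scal r u).
Proof. apply (cone_scal _ HX). Qed.

(** Source of the constant [2 * C] used everywhere below: contractivity is known on the cone only,
    and each of the two positive parts of [x] costs a factor [C]. *)
Lemma bound_of_cone (N : X -> R) (K : R) : 0 <= K ->
  (forall u v, N (minus u v) <= N u + N v) ->
  (forall u, cone u -> N u <= K * norm u) -> forall x, N x <= 2 * C * K * norm x.
Proof.
  intros HK Hm Hc x; destruct (Hdec x) as (u & v & Hu & Hv & E & Nu & Nv).
  rewrite E at 1; eapply Rle_trans; [apply Hm|].
  pose proof (Hc u Hu); pose proof (Hc v Hv).
  assert (K * norm u <= K * (C * norm x)) by (now apply Rmult_le_compat_l).
  assert (K * norm v <= K * (C * norm x)) by (now apply Rmult_le_compat_l).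
  lra.
Qed.

Lemma substochastic_bound T t u : @substochastic X0 cone T -> 0 <= t -> norm (T t u) <= 2 * C * norm u.
Proof.
  intros HT Ht; replace (2 * C) with (2 * C * 1) by ring.
  apply (bound_of_cone (fun u => norm (T t u))); [lra| |].
  - intros x y; rewrite (linear_minus (T t)) by (apply (sg_bounded _ (ss_C0 _ _ HT)), Ht).
    apply norm_minus_le.
  - intros x Hx; rewrite Rmult_1_l; now apply (ss_contractive _ _ HT).
Qed.

Context (U : R -> X -> X) (A B : pfun X X).
Context (HU : @substochastic X0 cone U) (HA : @generator X0 U A)
  (HBdom : forall u, dom B u <-> dom A u) (HBlin : @linear_pfun X0 B)
  (HBpos : @positive_pfun X0 cone B)
  (HAB : forall u, dom A u -> cone u -> Psi (@padd X0 A B u) <= 0).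

Lemma twice_C_ge0 : 0 <= 2 * C.
Proof. lra. Qed.

Lemma U_bound t u : 0 <= t -> norm (U t u) <= 2 * C * norm u.
Proof. now apply substochastic_bound. Qed.

Lemma U_C0 : @C0_semigroup X0 U.
Proof. apply (ss_C0 _ _ HU). Qed.

Lemma B_plus u v : dom A u -> dom A v -> B (plus u v) = plus (B u) (B v).
Proof. intros Hu Hv; apply HBlin; now apply HBdom. Qed.

Lemma B_scal r u : dom A u -> B (scal r u) = scal r (B u).
Proof. intros Hu; apply HBlin; now apply HBdom. Qed.

Lemma B_minus u v : dom A u -> dom A v -> B (minus u v) = minus (B u) (B v).
Proof.
  intros Hu Hv; replace (minus u v) with (plus u (scal (-1) v)) by module_eq.
  rewrite B_plus, B_scal; [module_eq|easy|easy|].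
  apply HBdom, HBlin, HBdom, Hv.
Qed.

Lemma B_cone u : dom A u -> cone u -> cone (B u).
Proof. intros Hu; apply HBpos; now apply HBdom. Qed.

Lemma Psi_A_B u : dom A u -> cone u -> Psi (B u) <= - Psi (A u).
Proof.
  intros Hu Cu; pose proof (HAB u Hu Cu) as H; unfold padd in H; cbn in H.
  change (Psi (plus (A u) (B u)) <= 0) in H; rewrite Psi_plus in H; lra.
Qed.

Lemma Psi_A u : dom A u -> cone u -> Psi (A u) <= 0.
Proof.
  intros Hu Cu; pose proof (Psi_A_B u Hu Cu); pose proof (Psi_ge0 _ (B_cone u Hu Cu)); lra.
Qed.

(** Rescaling by [exp (- t)] shifts the generator to A - 1. The decay makes the orbit integrals
    converge, and their limit is the resolvent of [A] at 1. *)
Definition damped t u : X := scal (exp (- t)) (U t u).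
Definition A_minus_id : pfun X X := PFun (dom A) (fun u => minus (A u) u).

Lemma damped_rlim u : rlim (fun h => damped h u) u.
Proof.
  assert (H : rlim (fun h => scal (exp (-1 * h)) (U h u)) (scal 1 u)).
  { apply rlim_scal_fun; [apply rlim_exp|apply (sg_continuous _ U_C0)]. }
  replace (scal 1 u) with u in H by module_eq.
  eapply rlim_ext; [|exact H]; intros h _; unfold damped; do 2 f_equal; ring.
Qed.

Lemma damped_C0 : @C0_semigroup X0 damped.
Proof.
  split.
  - intros t Ht; apply (is_linear_comp (U t) (fun x => scal (exp (- t)) x)).
    + apply (sg_bounded _ U_C0), Ht.
    + exact (is_linear_scal_r (K := R_AbsRing) (exp (- t)) (fun n m => Rmult_comm n m)).
  - intro u; unfold damped; rewrite (sg_zero _ U_C0), Ropp_0, exp_0; exact (scal_one u).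
  - intros t s u Ht Hs; unfold damped; rewrite (sg_plus _ U_C0) by easy.
    rewrite (linear_scal_R (U t)) by (apply (sg_bounded _ U_C0), Ht).
    rewrite Ropp_plus_distr, exp_plus; module_eq.
  - exact damped_rlim.
Qed.

Lemma damped_bound_exp t u : 0 <= t -> norm (damped t u) <= 2 * C * norm u * exp (- t).
Proof.
  intro Ht; unfold damped; rewrite norm_scal_eq, Rabs_pos_eq by (apply Rlt_le, exp_pos).
  rewrite Rmult_comm; apply Rmult_le_compat_r; [apply Rlt_le, exp_pos|now apply U_bound].
Qed.

Lemma damped_bound t u : 0 <= t -> norm (damped t u) <= 2 * C * norm u.
Proof.
  intro Ht; eapply Rle_trans; [now apply damped_bound_exp|].
  assert (He : exp (- t) <= 1).
  { destruct (Req_dec t 0) as [->|Hne]; [rewrite Ropp_0, exp_0; lra|].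
    rewrite <- exp_0; apply Rlt_le, exp_increasing; lra. }
  pose proof (Rmult_le_pos _ _ twice_C_ge0 (norm_ge_0 u)); nra.
Qed.

Lemma damped_generatorP (u w : X) :
  maps A_minus_id u w <-> rlim (fun h => scal (/ h) (minus (damped h u) u)) w.
Proof.
  assert (E : maps A_minus_id u w <-> maps A u (plus w u)).
  { unfold maps, A_minus_id; cbn; split; intros [Hd E]; split; try easy.
    - rewrite <- E; module_eq.
    - rewrite E; module_eq. }
  rewrite E, (generatorP U A HA).
  split; intro H.
  - apply (rlim_exp_scal (-1)) in H.
    replace (plus (plus w u) (scal (-1) u)) with w in H by module_eq.
    eapply rlim_ext; [|exact H]; intros h _; unfold damped; do 4 f_equal; ring.
  - apply (rlim_exp_scal 1) in H.
    replace (plus w (scal 1 u)) with (plus w u) in H by module_eq.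
    eapply rlim_ext; [|exact H]; intros h _; unfold damped.
    do 2 f_equal; transitivity (scal (exp (1 * h) * exp (- h)) (U h u)); [module_eq|].
    rewrite <- exp_plus; replace (1 * h + - h) with 0 by ring; rewrite exp_0; module_eq.
Qed.

Lemma damped_generator : @generator X0 damped A_minus_id.
Proof. exact damped_generatorP. Qed.

Lemma A_maps_damped u w : maps A_minus_id u w -> maps A u (plus w u).
Proof. unfold maps, A_minus_id; cbn; intros [Hd <-]; split; [easy|module_eq]. Qed.

(** [x] is the limit of the integrals of exp(-s)U(s)f over [[0, n]]. These are positive and form a
    Cauchy sequence; the equation survives because [A] is closed. *)
Lemma resolvent_cone f : cone f -> exists x, cone x /\ maps A x (minus x f).
Proof.
  intro Cf.
  set (J := orbit_int damped).
  assert (HJ : forall n, maps A (J (INR n) f) (plus (minus (damped (INR n) f) f) (J (INR n) f))).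
  { intro n; apply A_maps_damped.
    apply (generator_orbit_int (2 * C) damped A_minus_id damped_C0 twice_C_ge0 damped_bound damped_generator), pos_INR. }
  assert (CT : forall t, 0 <= t -> cone (damped t f)).
  { intros t Ht; apply cone_mul; [apply Rlt_le, exp_pos|now apply (ss_positive _ _ HU)]. }
  assert (CJ : forall n, cone (J (INR n) f)).
  { intro n; apply (is_RInt_in_cone cone HX (fun s => damped s f) 0 (INR n)); [apply pos_INR| |].
    - intros s Hs; apply CT; lra.
    - apply (C0_is_RInt (2 * C) damped damped_C0 twice_C_ge0 damped_bound), pos_INR. }
  (* [Psi] is applied to [HJ]: its value on the image under [A] is at most 0, and the term with
     [damped] is nonnegative. *)
  assert (NJ : forall n, norm (J (INR n) f) <= norm f).
  { intro n; rewrite <- !Psi_norm by easy.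
    pose proof (HJ n) as [Hd E]; pose proof (Psi_A _ Hd (CJ n)) as H.
    rewrite E, Psi_plus, Psi_minus in H.
    pose proof (Psi_ge0 _ (CT (INR n) (pos_INR n))); lra. }
  (* The difference is [damped (INR n)] applied to [J (INR m) f], so exponential decay combines with
     the uniform bound [NJ]. *)
  assert (DJ : forall n m, norm (minus (J (INR (m + n)) f) (J (INR n) f)) <= 2 * C * norm f * exp (- INR n)).
  { intros n m; rewrite plus_INR.
    pose proof (orbit_int_shift_l _ _ (C0_toeplitz (2 * C) damped damped_C0 twice_C_ge0 damped_bound)
      O (INR m) (INR n) f (pos_INR m) (pos_INR n)) as E.
    rewrite sum_O in E; cbv beta iota in E; unfold J; rewrite E; cbv beta iota.
    eapply Rle_trans; [apply damped_bound_exp, pos_INR|].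
    apply Rmult_le_compat_r; [apply Rlt_le, exp_pos|].
    apply Rmult_le_compat_l; [apply twice_C_ge0|apply NJ]. }
  assert (Hc : 0 <= 2 * C * norm f) by (apply Rmult_le_pos; [apply twice_C_ge0|apply norm_ge_0]).
  destruct (complete_seq (fun n => J (INR n) f)) as [x Hx].
  { intros eps He; destruct (exp_neg_small (2 * C * norm f) (eps / 2) Hc ltac:(lra)) as [N HN].
    exists N; intros n m Hn Hm; specialize (HN N (le_n N)).
    pose proof (DJ N (n - N)%nat) as H1; pose proof (DJ N (m - N)%nat) as H2.
    replace (n - N + N)%nat with n in H1 by lia; replace (m - N + N)%nat with m in H2 by lia.
    pose proof (norm_minus_triangle (J (INR n) f) (J (INR N) f) (J (INR m) f)) as H3.
    rewrite (norm_minus_sym (J (INR N) f)) in H3; lra. }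
  exists x; split.
  - apply (closed_eps cone (cone_closed _ HX)); intros eps He.
    destruct (Hx eps He) as [N HN]; exists (J (INR N) f); split; [apply CJ|now apply HN].
  - apply (generator_closed (2 * C) U A U_C0 twice_C_ge0 U_bound HA); intros eps He.
    destruct (Hx (eps / 2) ltac:(lra)) as [N1 H1].
    destruct (exp_neg_small (2 * C * norm f) (eps / 2) Hc ltac:(lra)) as [N2 H2].
    set (n := (N1 + N2)%nat).
    specialize (H1 n ltac:(lia)); specialize (H2 n ltac:(lia)).
    eexists; eexists; split; [apply (HJ n)|]; split; [lra|].
    eapply Rle_lt_trans; [apply (norm_of_plus _ (damped (INR n) f) (minus (J (INR n) f) x)); module_eq|].
    pose proof (damped_bound_exp (INR n) f (pos_INR n)); lra.
Qed.

(** Such an [x] is killed by A - 1, so its damped orbit is constant; but that orbit tends to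
    zero. *)
Lemma resolvent_unique x : maps A x x -> x = zero.
Proof.
  intro Hx.
  assert (Hx' : maps A_minus_id x zero).
  { destruct Hx as [Hd E]; split; [exact Hd|]; change (minus (A x) x = zero); rewrite E; module_eq. }
  assert (E : forall n, damped (INR n) x = x).
  { intro n; apply minus_zero_eq.
    rewrite (orbit_int_generator (2 * C) damped A_minus_id damped_C0 twice_C_ge0 damped_bound damped_generator
      (INR n) x zero (pos_INR n) Hx').
    apply (linear_zero (orbit_int damped (INR n))).
    apply (C0_int_linear (2 * C) damped damped_C0 twice_C_ge0 damped_bound), pos_INR. }
  apply eq_of_norm_lt; intros eps He.
  apply Rle_lt_trans with (norm x); [right; f_equal; module_eq|].
  destruct (exp_neg_small (2 * C * norm x) eps) as [N HN]; [|easy|].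
  { apply Rmult_le_pos; [apply twice_C_ge0|apply norm_ge_0]. }
  rewrite <- (E N); eapply Rle_lt_trans; [apply damped_bound_exp, pos_INR|]; now apply HN.
Qed.

(** [L] is B(1-A)^(-1). It is bounded because positive [y] and [g] with [A y = y - g] satisfy
    Psi(By) <= -Psi(Ay) = Psi(g) - Psi(y) <= Psi(g); general [f] are split into positive parts. *)
Lemma B_resolvent : exists L : X -> X, is_linear L /\ forall u, dom A u -> B u = L (minus u (A u)).
Proof.
  assert (H : forall f, exists x, maps A x (minus x f) /\ norm (B x) <= 2 * C * norm f).
  { intro f; destruct (Hdec f) as (f1 & f2 & C1 & C2 & E & N1 & N2).
    destruct (resolvent_cone f1 C1) as (x1 & Cx1 & H1).
    destruct (resolvent_cone f2 C2) as (x2 & Cx2 & H2).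
    assert (HB : forall y g, cone y -> cone g -> maps A y (minus y g) -> norm (B y) <= norm g).
    { intros y g Cy Cg [Hd Hy].
      rewrite <- !Psi_norm; [|easy|now apply B_cone].
      pose proof (Psi_A_B y Hd Cy) as K; rewrite Hy, Psi_minus in K.
      pose proof (Psi_ge0 y Cy); lra. }
    exists (minus x1 x2); split.
    - replace (minus (minus x1 x2) f) with (minus (minus x1 f1) (minus x2 f2)) by (rewrite E; module_eq).
      now apply (generator_minus U A U_C0 HA).
    - rewrite B_minus by (apply H1 || apply H2).
      pose proof (norm_minus_le (B x1) (B x2)).
      pose proof (HB _ _ Cx1 C1 H1); pose proof (HB _ _ Cx2 C2 H2); lra. }
  apply functional_choice in H; destruct H as [Res HR].
  assert (Uniq : forall x f, maps A x (minus x f) -> Res f = x).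
  { intros x f Hx; apply minus_zero_eq, resolvent_unique.
    destruct (HR f) as [Hf _].
    replace (minus (Res f) x) with (minus (minus (Res f) f) (minus x f)) at 2 by module_eq.
    now apply (generator_minus U A U_C0 HA). }
  exists (fun f => B (Res f)); split; [split|].
  - intros f g; destruct (HR f) as [Hf _]; destruct (HR g) as [Hg _].
    rewrite <- B_plus by (apply Hf || apply Hg); f_equal; apply Uniq.
    replace (minus (plus (Res f) (Res g)) (plus f g))
      with (plus (minus (Res f) f) (minus (Res g) g)) by module_eq.
    now apply (generator_plus U A U_C0 HA).
  - intros k f; destruct (HR f) as [Hf _].
    etransitivity; [|apply B_scal, Hf]; f_equal; apply Uniq.
    eapply maps_eq; [exact (generator_scal U A U_C0 HA k _ _ Hf)|easy|module_eq].
  - exists (2 * C); split; [lra|]; intro f; apply HR.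
  - intros u Hu; cbv beta; f_equal; symmetry; apply Uniq.
    replace (minus u (minus u (A u))) with (A u) by module_eq; now split.
Qed.

(** * Dyson-Phillips iterates *)

Context (L : X -> X) (HL : is_linear L) (HBL : forall u, dom A u -> B u = L (minus u (A u))).

Lemma dom_mean h u : 0 < h -> dom A (scal (/ h) (orbit_int U h u)).
Proof.
  intro Hh; apply (generator_scal U A U_C0 HA (/ h) _ (minus (U h u) u)).
  apply (generator_orbit_int (2 * C) U A U_C0 twice_C_ge0 U_bound HA); lra.
Qed.

Lemma mean_rlim u : rlim (fun h => scal (/ h) (orbit_int U h u)) u.
Proof. exact (orbit_int_mean (2 * C) U U_C0 twice_C_ge0 U_bound u). Qed.

Lemma orbit_cone (W : R -> X -> X) t u I : 0 <= t -> (forall s, 0 <= s -> cone (W s u)) ->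
  is_RInt (fun s => W s u) 0 t I -> cone I.
Proof.
  intros Ht HW; apply (is_RInt_in_cone cone HX); [easy|].
  intros s Hs; apply HW; lra.
Qed.

(** Time averages of the orbit of a positive [u] are positive, lie in [dom A] and tend to [u], so
    the positive part of [dom A] is dense in the cone. *)
Lemma dense_cone_ge0 (Phi : X -> R) : is_linear Phi ->
  (forall x, dom A x -> cone x -> 0 <= Phi x) -> forall u, cone u -> 0 <= Phi u.
Proof.
  intros HPhi H u Hu.
  apply (rlim_ge0 (fun h => Phi (scal (/ h) (orbit_int U h u)))).
  - intros h Hh; apply H; [now apply dom_mean|].
    apply cone_mul; [apply Rlt_le, Rinv_0_lt_compat, Hh|].
    apply (orbit_cone U h u); [lra| |].
    + intros s Hs; now apply (ss_positive _ _ HU).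
    + apply (C0_is_RInt (2 * C) U U_C0 twice_C_ge0 U_bound); lra.
  - apply (rlim_linear Phi); [easy|apply mean_rlim].
Qed.

Lemma dense_eq (L1 L2 : X -> X) : is_linear L1 -> is_linear L2 ->
  (forall x, dom A x -> L1 x = L2 x) -> forall u, L1 u = L2 u.
Proof.
  intros H1 H2 H u; eapply rlim_unique.
  - exact (rlim_linear L1 _ _ H1 (mean_rlim u)).
  - eapply rlim_ext; [|exact (rlim_linear L2 _ _ H2 (mean_rlim u))].
    intros h Hh; symmetry; apply H, dom_mean, Hh.
Qed.

Lemma dense_rlim (W : R -> X -> X) (M : R) :
  0 <= M -> (forall h, 0 <= h -> is_linear (W h)) ->
  (forall h u, 0 <= h -> norm (W h u) <= M * norm u) ->
  (forall x, dom A x -> rlim (fun h => W h x) (zero : X)) ->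
  forall u, rlim (fun h => W h u) (zero : X).
Proof.
  intros HM HW Hb H u; apply rlim_eps; intros eps He.
  set (e := eps / (2 * (M + 1))).
  assert (He' : 0 < e) by (apply Rdiv_lt_0_compat; lra).
  destruct (proj1 (rlim_eps _ _) (mean_rlim u) e He') as (d & Hd & Hx).
  set (x := scal (/ (d / 2)) (orbit_int U (d / 2) u)).
  assert (Nx : norm (minus x u) < e) by (apply Hx; lra).
  assert (Dx : dom A x) by (apply dom_mean; lra).
  destruct (proj1 (rlim_eps _ _) (H x Dx) (eps / 2) ltac:(lra)) as (d' & Hd' & Hx').
  exists d'; split; [easy|]; intros h Hh; specialize (Hx' h Hh).
  eapply Rle_lt_trans.
  { apply (norm_of_plus _ (minus (W h x) (zero : X)) (opp (W h (minus x u)))).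
    rewrite (linear_minus (W h)) by (apply HW; lra); module_eq. }
  rewrite norm_opp.
  pose proof (Hb h (minus x u) ltac:(lra)) as H1.
  assert (H2 : M * norm (minus x u) <= M * e) by (apply Rmult_le_compat_l; lra).
  assert (E : (M + 1) * e = eps / 2) by (unfold e; field; lra).
  lra.
Qed.

Context (Vn : nat -> R -> X -> X) (HVn : @dyson_phillips X0 cone U A B Vn).

Lemma Vn_O t u : 0 <= t -> Vn 0 t u = U t u.
Proof. apply (dp_0 _ _ _ _ _ HVn). Qed.

Lemma Vn_linear n t : 0 <= t -> is_linear (Vn n t).
Proof.
  intro Ht; destruct n as [|n]; [|now apply (dp_bounded _ _ _ _ _ HVn)].
  apply (is_linear_ext (U t)); [intro u; symmetry; now apply Vn_O|].
  now apply (sg_bounded _ U_C0).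
Qed.

Lemma Vn_cone n t u : 0 <= t -> cone u -> cone (Vn n t u).
Proof.
  intros Ht Hu; destruct n as [|n]; [|now apply (dp_positive _ _ _ _ _ HVn)].
  rewrite Vn_O by easy; now apply (ss_positive _ _ HU).
Qed.

Lemma Vn_S n t u : 0 <= t -> dom A u ->
  is_RInt (fun s => Vn n (t - s) (B (U s u))) 0 t (Vn (S n) t u).
Proof. apply (dp_S _ _ _ _ _ HVn). Qed.

Lemma dom_U t u : 0 <= t -> dom A u -> dom A (U t u) /\ A (U t u) = U t (A u).
Proof.
  intros Ht Hu; apply (generator_orbit U A U_C0 HA t u (A u) Ht); now split.
Qed.

(** For [u] in [dom A], the induction hypothesis at time [t - s] bounds the integrand of the shifted
    sum by Psi(BU(s)u) <= -Psi(AU(s)u), whose integral is Psi(u) - Psi(U(t)u); this absorbs the term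
    of index 0. Density gives the rest of the cone. *)
Lemma Vn_Psi_sum N t u : 0 <= t -> cone u -> sum_n (fun k => Psi (Vn k t u)) N <= Psi u.
Proof.
  revert t u; induction N as [|N IH]; intros t u Ht Hu.
  { rewrite sum_O, Vn_O by easy; rewrite !Psi_norm; [|easy|now apply (ss_positive _ _ HU)].
    now apply (ss_contractive _ _ HU). }
  enough (H : 0 <= plus (Psi u) (opp (sum_n (fun k => Psi (Vn k t u)) (S N)))).
  { change (0 <= Psi u + - sum_n (fun k => Psi (Vn k t u)) (S N)) in H; lra. }
  revert u Hu; apply dense_cone_ge0.
  { apply (is_linear_add (W := R_NormedModule)); [apply Psi_linear|].
    apply (is_linear_comp _ (opp (G := R_NormedModule))); [|apply is_linear_opp].
    apply (is_linear_sum_n (fun k u => Psi (Vn k t u))); intros k _.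
    apply (is_linear_comp (Vn k t) Psi); [now apply Vn_linear|apply Psi_linear]. }
  intros u Du Cu.
  rewrite sum_n_shift, Vn_O by easy.
  assert (H1 : is_RInt (fun s => sum_n (fun k => Psi (Vn k (t - s) (B (U s u)))) N) 0 t
    (sum_n (fun k => Psi (Vn (S k) t u)) N)).
  { apply (is_RInt_sum_n (fun k s => Psi (Vn k (t - s) (B (U s u))))); intros k _.
    apply (is_RInt_linear Psi Psi_linear (fun s => Vn k (t - s) (B (U s u)))).
    now apply Vn_S. }
  assert (H2 : is_RInt (fun s => opp (Psi (U s (A u)))) 0 t (opp (Psi (orbit_int U t (A u))))).
  { apply (is_RInt_opp (V := R_NormedModule)), (is_RInt_linear Psi Psi_linear (fun s => U s (A u))).
    now apply (C0_is_RInt (2 * C) U U_C0 twice_C_ge0 U_bound). }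
  apply (is_RInt_le _ _ _ _ _ _ Ht H1) in H2.
  - rewrite <- (orbit_int_generator (2 * C) U A U_C0 twice_C_ge0 U_bound HA t u (A u) Ht) in H2 by (now split).
    rewrite Psi_minus in H2; change (sum_n (fun k => Psi (Vn (S k) t u)) N <= - (Psi (U t u) - Psi u)) in H2.
    change (0 <= Psi u + - (Psi (U t u) + sum_n (fun k => Psi (Vn (S k) t u)) N)); lra.
  - intros s Hs; destruct (dom_U s u ltac:(lra) Du) as [Ds Es].
    assert (Cs : cone (U s u)) by (apply (ss_positive _ _ HU); [lra|easy]).
    eapply Rle_trans; [apply IH; [lra|now apply B_cone]|].
    rewrite <- Es; now apply Psi_A_B.
Qed.

Lemma Vn_Psi_le n t u : 0 <= t -> cone u -> Psi (Vn n t u) <= Psi u.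
Proof.
  intros Ht Hu; eapply Rle_trans; [|apply (Vn_Psi_sum n t u Ht Hu)].
  destruct n as [|n]; [rewrite sum_O; lra|].
  rewrite sum_Sn; change (Psi (Vn (S n) t u) <= sum_n (fun k => Psi (Vn k t u)) n + Psi (Vn (S n) t u)).
  assert (0 <= sum_n (fun k => Psi (Vn k t u)) n); [|lra].
  clear - Ht Hu HPsi HVn HX HU. induction n as [|n IH].
  - rewrite sum_O; now apply Psi_ge0, Vn_cone.
  - rewrite sum_Sn; apply Rplus_le_le_0_compat; [easy|now apply Psi_ge0, Vn_cone].
Qed.

Lemma Vn_bound n t u : 0 <= t -> norm (Vn n t u) <= 2 * C * norm u.
Proof.
  intro Ht; replace (2 * C) with (2 * C * 1) by ring.
  apply (bound_of_cone (fun u => norm (Vn n t u))); [lra| |].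
  - intros x y; rewrite (linear_minus (Vn n t)) by (now apply Vn_linear).
    apply norm_minus_le.
  - intros x Hx; rewrite Rmult_1_l, <- !Psi_norm; [|easy|now apply Vn_cone].
    now apply Vn_Psi_le.
Qed.

(** On [dom A], the integral defining the iterate of index [S n] at [t + s] is cut at [s]. On the
    first piece the induction hypothesis yields the terms with [k >= 1]; the second, translated by
    [s], is the term with [k = 0]. *)
Lemma Vn_plus n t s u : 0 <= t -> 0 <= s ->
  Vn n (t + s) u = sum_n (fun k => Vn (n - k)%nat t (Vn k s u)) n.
Proof.
  revert t s u; induction n as [|n IH]; intros t s u Ht Hs.
  { rewrite sum_O; simpl; rewrite !Vn_O by lra; now apply (sg_plus _ U_C0). }
  revert u; apply (dense_eq (Vn (S n) (t + s))).
  { apply Vn_linear; lra. }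
  { apply (is_linear_sum_n (fun k u => Vn (S n - k)%nat t (Vn k s u))); intros k _.
    apply (is_linear_comp (Vn k s) (Vn (S n - k)%nat t)); now apply Vn_linear. }
  intros u Du.
  eapply RInt_eq; [apply Vn_S; [lra|easy]|].
  rewrite sum_n_shift, plus_comm; apply (is_RInt_Chasles _ _ s).
  - apply (is_RInt_ext (fun r => sum_n (fun k => Vn (n - k)%nat t (Vn k (s - r) (B (U r u)))) n)).
    { intros r Hr; rewrite Rmin_left, Rmax_right in Hr by lra.
      rewrite <- IH by lra; f_equal; ring. }
    apply (is_RInt_sum_n (fun k r => Vn (n - k)%nat t (Vn k (s - r) (B (U r u))))); intros k _.
    apply (is_RInt_linear (Vn (n - k)%nat t)); [now apply Vn_linear|now apply Vn_S].
  - replace (S n - 0)%nat with (S n) by lia; rewrite Vn_O by easy.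
    apply (is_RInt_ext (fun r => Vn n (t - (r + - s)) (B (U (r + - s) (U s u))))).
    { intros r Hr; rewrite Rmin_left, Rmax_right in Hr by lra.
      rewrite <- (sg_plus _ U_C0) by lra.
      f_equal; [ring|do 2 f_equal; ring]. }
    apply (is_RInt_shift (fun r => Vn n (t - r) (B (U r (U s u))))).
    replace (s + - s) with 0 by ring; replace (t + s + - s) with t by ring.
    apply Vn_S; [easy|now apply dom_U].
Qed.

Lemma B_U_rlim u : dom A u -> rlim (fun s => B (U s u)) (B (U 0 u)).
Proof.
  intro Du; rewrite (sg_zero _ U_C0), HBL by easy.
  apply (rlim_ext (fun s => L (minus (U s u) (U s (A u))))).
  { intros s Hs; destruct (dom_U s u ltac:(lra) Du) as [Ds Es]; rewrite HBL, Es; easy. }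
  apply (rlim_linear L); [easy|].
  apply rlim_minus; apply (sg_continuous _ U_C0).
Qed.

Lemma Vn_S_0 n u : Vn (S n) 0 u = zero.
Proof.
  revert u; apply (dense_eq _ (fun _ => zero)); [apply Vn_linear; lra|apply is_linear_zero|].
  intros x Dx; eapply RInt_eq; [apply Vn_S; [lra|easy]|apply is_RInt_point].
Qed.

Lemma Vn_0_0 u : Vn 0 0 u = u.
Proof. rewrite Vn_O by lra; apply (sg_zero _ U_C0). Qed.

(** Continuity at index [n] is a premise because [Vn_cont] is proved by induction from this lemma: a
    derivative at index [S n] on [dom A] forces continuity there, and uniform bounds extend it to
    [X]. *)
Lemma Vn_S_derivative n u : (forall v, rlim (fun h => Vn n h v) (Vn n 0 v)) -> dom A u ->
  rlim (fun h => scal (/ h) (Vn (S n) h u)) (Vn n 0 (B u)).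
Proof.
  intros Hn Du; apply rlim_eps; intros eps He.
  set (e := eps / (2 * (2 * C + 1))).
  assert (He' : 0 < e) by (apply Rdiv_lt_0_compat; lra).
  assert (Ee : (2 * C + 1) * e = eps / 2) by (unfold e; field; lra).
  destruct (rlim_eps_0 _ (Hn (B u)) e He') as (d1 & Hd1 & H1).
  destruct (rlim_eps_0 _ (B_U_rlim u Du) e He') as (d2 & Hd2 & H2).
  cbv beta in H2; rewrite (sg_zero _ U_C0) in H2.
  exists (Rmin d1 d2); split; [now apply Rmin_glb_lt|]; intros h Hh.
  pose proof (Rmin_l d1 d2); pose proof (Rmin_r d1 d2).
  rewrite (norm_of_scal (/ h) _ (minus (Vn (S n) h u) (scal (h - 0) (Vn n 0 (B u)))))
    by (module_eq_with ltac:(field; lra)).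
  rewrite Rabs_pos_eq by (apply Rlt_le, Rinv_0_lt_compat; lra).
  apply Rmult_lt_reg_l with h; [lra|]; rewrite <- Rmult_assoc, Rinv_r, Rmult_1_l by lra.
  apply Rle_lt_trans with ((h - 0) * (eps / 2)); [|nra].
  apply (norm_RInt_le_const (fun s => minus (Vn n (h - s) (B (U s u))) (Vn n 0 (B u)))); [lra| |].
  - intros s Hs.
    eapply Rle_trans; [apply (norm_minus_triangle _ (Vn n (h - s) (B u)))|].
    rewrite <- (linear_minus (Vn n (h - s))) by (apply Vn_linear; lra).
    pose proof (Vn_bound n (h - s) (minus (B (U s u)) (B u)) ltac:(lra)) as K1.
    specialize (H1 (h - s) ltac:(lra)); specialize (H2 s ltac:(lra)).
    assert (2 * C * norm (minus (B (U s u)) (B u)) <= 2 * C * e) by (apply Rmult_le_compat_l; lra).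
    lra.
  - apply is_RInt_minus; [apply Vn_S; [lra|easy]|apply is_RInt_const].
Qed.

Lemma Vn_cont n u : rlim (fun h => Vn n h u) (Vn n 0 u).
Proof.
  revert u; induction n as [|n IH]; intro u.
  { rewrite Vn_0_0; apply (rlim_ext (fun h => U h u)); [intros h Hh; symmetry; apply Vn_O; lra|].
    apply (sg_continuous _ U_C0). }
  rewrite Vn_S_0; revert u; apply (dense_rlim (Vn (S n)) (2 * C)).
  - apply twice_C_ge0.
  - intros h Hh; now apply Vn_linear.
  - intros h u Hh; now apply Vn_bound.
  - intros x Dx.
    assert (H : rlim (fun h => scal h (scal (/ h) (Vn (S n) h x))) (scal 0 (Vn n 0 (B x)))).
    { apply rlim_scal_fun; [apply rlim_id|now apply Vn_S_derivative]. }
    replace (scal 0 (Vn n 0 (B x))) with (zero : X) in H by module_eq.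
    eapply rlim_ext; [|exact H]; intros h Hh; cbv beta; module_eq_with ltac:(field; lra).
Qed.

Lemma Vn_toeplitz : toeplitz_semigroup (2 * C) Vn.
Proof.
  split.
  - apply twice_C_ge0.
  - apply Vn_linear.
  - apply Vn_bound.
  - apply Vn_plus.
  - apply Vn_cont.
Qed.

Lemma Vn_derivative n u : dom A u -> rlim (fun h => scal (/ h) (Vn (S n) h u)) (Vn n 0 (B u)).
Proof. apply Vn_S_derivative, Vn_cont. Qed.

Definition J n t u : X := orbit_int (Vn n) t u.
(** Terms of index -1 count as zero, here and in [J_pred] and [c_pred], so that one formula covers
    [n = 0]. *)
Definition BJ_pred n t u : X := match n with O => zero | S m => B (J m t u) end.
Definition J_pred n t u : X := match n with O => zero | S m => J m t u end.

Lemma J_linear n t : 0 <= t -> is_linear (J n t).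
Proof. exact (orbit_int_linear _ _ Vn_toeplitz n t). Qed.

Lemma J_is_RInt n t u : 0 <= t -> is_RInt (fun s => Vn n s u) 0 t (J n t u).
Proof. exact (is_RInt_orbit _ _ Vn_toeplitz n t u). Qed.

Lemma J_quotient n t u : 0 <= t ->
  rlim (fun h => scal (/ h) (minus (sum_n (fun k => Vn (n - k)%nat h (J k t u)) n : X) (J n t u)))
    (minus (Vn n t u) (Vn n 0 u)).
Proof.
  intro Ht; eapply rlim_ext; [|exact (orbit_int_quotient _ _ Vn_toeplitz n t u Ht)].
  intros h Hh; cbv beta.
  rewrite (orbit_int_shift_l _ _ Vn_toeplitz n t h u Ht) by lra; easy.
Qed.

Lemma J_quotient_r n t u : 0 <= t ->
  rlim (fun h => scal (/ h) (minus (sum_n (fun k => J (n - k)%nat t (Vn k h u)) n : X) (J n t u)))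
    (minus (Vn n t u) (Vn n 0 u)).
Proof.
  intro Ht; eapply rlim_ext; [|exact (orbit_int_quotient _ _ Vn_toeplitz n t u Ht)].
  intros h Hh; cbv beta.
  rewrite (orbit_int_shift_r _ _ Vn_toeplitz n t h u Ht) by lra; easy.
Qed.

(* The left form of the shift identity gives the generator at [J n t u], the right form
   ([Vn_minus]) moves the generator inside. *)
Lemma J_maps n t u : 0 <= t ->
  maps A (J n t u) (minus (minus (Vn n t u) (Vn n 0 u)) (BJ_pred n t u)).
Proof.
  intro Ht; induction n as [n IH] using (well_founded_induction Nat.lt_wf_0).
  apply (generatorP U A HA).
  pose proof (J_quotient n t u Ht) as HQ.
  destruct n as [|m].
  - apply (rlim_ext (fun h => minus
      (scal (/ h) (minus (sum_n (fun k => Vn (0 - k)%nat h (J k t u)) 0 : X) (J 0 t u))) zero)).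
    { intros h Hh; rewrite sum_O, Vn_O by lra; module_eq. }
    apply rlim_minus; [exact HQ|apply rlim_const].
  (* These are the terms of [HQ] other than [k = S m]. Their limits contain the value at time 0 of
     the iterate of index [m - k], which vanishes unless [k = m]; what remains of [HQ] is the
     quotient of [U] at [J (S m) t u]. *)
  - assert (HS : rlim (fun h => sum_n (fun k => scal (/ h) (Vn (S m - k)%nat h (J k t u))) m)
      (sum_n (fun k => Vn (m - k)%nat 0 (B (J k t u))) m)).
    { apply (rlim_sum_n (fun k h => scal (/ h) (Vn (S m - k)%nat h (J k t u)))).
      intros k Hk; replace (S m - k)%nat with (S (m - k)) by lia.
      apply Vn_derivative, (IH k); lia. }
    rewrite sum_n_last in HS.
    2:{ intros k Hk; replace (m - k)%nat with (S (m - k - 1)) by lia; apply Vn_S_0. }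
    replace (m - m)%nat with O in HS by lia; rewrite Vn_0_0 in HS.
    eapply rlim_ext; [|exact (rlim_minus _ _ _ _ HQ HS)].
    intros h Hh; cbv beta.
    rewrite sum_Sn; replace (S m - S m)%nat with O by lia; rewrite Vn_O by lra.
    rewrite sum_n_scal; module_eq.
Qed.

Lemma Vn_minus n t v : 0 <= t -> dom A v ->
  minus (Vn n t v) (Vn n 0 v) = plus (J n t (A v)) (J_pred n t (B v)).
Proof.
  intros Ht Dv; eapply rlim_unique; [exact (J_quotient_r n t v Ht)|].
  assert (HA1 : rlim (fun h => J n t (scal (/ h) (minus (U h v) v))) (J n t (A v))).
  { apply (rlim_linear (J n t)); [now apply J_linear|].
    apply (generatorP U A HA); now split. }
  destruct n as [|m].
  - apply (rlim_ext (fun h => plus (J 0 t (scal (/ h) (minus (U h v) v))) zero)).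
    { intros h Hh; rewrite sum_O, (linear_quotient (J 0 t)) by (now apply J_linear).
      rewrite Vn_O by lra; simpl; module_eq. }
    apply rlim_plus; [exact HA1|apply rlim_const].
  (* Mirror image of the argument in [J_maps]: the value of [Vn k] at time 0 leaves only the term
     [k = 0]. *)
  - assert (HS : rlim (fun h => sum_n (fun k => J (m - k)%nat t (scal (/ h) (Vn (S k) h v))) m)
      (sum_n (fun k => J (m - k)%nat t (Vn k 0 (B v))) m)).
    { apply (rlim_sum_n (fun k h => J (m - k)%nat t (scal (/ h) (Vn (S k) h v)))).
      intros k Hk; apply (rlim_linear (J (m - k)%nat t)); [now apply J_linear|].
      now apply Vn_derivative. }
    rewrite sum_n_first in HS.
    2:{ intros k Hk; replace k with (S (k - 1)) at 2 by lia; rewrite Vn_S_0.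
        apply (linear_zero (J (m - k)%nat t)); now apply J_linear. }
    replace (m - 0)%nat with m in HS by lia; rewrite Vn_0_0 in HS.
    eapply rlim_ext; [|exact (rlim_plus _ _ _ _ HA1 HS)].
    intros h Hh; cbv beta.
    rewrite sum_n_shift, Vn_O by lra; replace (S m - 0)%nat with (S m) by lia.
    rewrite (linear_quotient (J (S m) t)) by (now apply J_linear).
    rewrite (sum_n_ext _ (fun k => scal (/ h) (J (S m - S k)%nat t (Vn (S k) h v)))).
    2:{ intro k; apply (linear_scal_R (J (m - k)%nat t)); now apply J_linear. }
    rewrite sum_n_scal; module_eq.
Qed.

(** * The functional *)

(** Coincides with [a_fun] on [dom A], since [G] extends [padd A B]; written without [G], which
    enters only in [ahat_closure]. *)
Definition ell u : R := - (Psi (A u) + Psi (B u)).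
Definition c n t u : R := ell (J n t u).
Definition c_pred n t u : R := match n with O => 0 | S m => c m t u end.
Definition sigma t u : R := Series (fun n => c n t u).

Lemma A_plus u v : dom A u -> dom A v -> dom A (plus u v) /\ A (plus u v) = plus (A u) (A v).
Proof. intros Hu Hv; apply (generator_plus U A U_C0 HA u v); now split. Qed.

Lemma A_minus u v : dom A u -> dom A v -> dom A (minus u v) /\ A (minus u v) = minus (A u) (A v).
Proof. intros Hu Hv; apply (generator_minus U A U_C0 HA u v); now split. Qed.

Lemma A_zero : dom A zero /\ A zero = zero.
Proof.
  apply (generatorP U A HA zero zero).
  apply (rlim_ext (fun _ => zero : X)); [|apply rlim_const].
  intros h Hh; rewrite (linear_zero (U h)) by (apply (sg_bounded _ U_C0); lra).
  module_eq.
Qed.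

Lemma ell_plus u v : dom A u -> dom A v -> ell (plus u v) = ell u + ell v.
Proof.
  intros Hu Hv; unfold ell.
  rewrite (proj2 (A_plus u v Hu Hv)), B_plus, !Psi_plus by easy; ring.
Qed.

Lemma ell_minus u v : dom A u -> dom A v -> ell (minus u v) = ell u - ell v.
Proof.
  intros Hu Hv; unfold ell.
  rewrite (proj2 (A_minus u v Hu Hv)), B_minus, !Psi_minus by easy; ring.
Qed.

Lemma ell_zero : ell zero = 0.
Proof.
  destruct A_zero as [D0 _].
  pose proof (ell_plus (zero : X) zero D0 D0) as H.
  rewrite plus_zero_l in H; lra.
Qed.

Lemma ell_ge0 u : dom A u -> cone u -> 0 <= ell u.
Proof. intros Du Cu; pose proof (Psi_A_B u Du Cu); unfold ell; lra. Qed.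

Lemma J_dom n t u : 0 <= t -> dom A (J n t u).
Proof. intro Ht; apply (J_maps n t u Ht). Qed.

Lemma J_cone n t u : 0 <= t -> cone u -> cone (J n t u).
Proof.
  intros Ht Hu; apply (orbit_cone (Vn n) t u); [easy| |now apply J_is_RInt].
  intros s Hs; now apply Vn_cone.
Qed.

Lemma c_ge0 n t u : 0 <= t -> cone u -> 0 <= c n t u.
Proof. intros Ht Hu; apply ell_ge0; [now apply J_dom|now apply J_cone]. Qed.

Lemma c_minus n t u v : 0 <= t -> c n t (minus u v) = c n t u - c n t v.
Proof.
  intro Ht; unfold c; rewrite (linear_minus (J n t)) by (now apply J_linear).
  apply ell_minus; now apply J_dom.
Qed.

Lemma c_plus n t u v : 0 <= t -> c n t (plus u v) = c n t u + c n t v.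
Proof.
  intro Ht; unfold c; rewrite (linear_plus (J n t)) by (now apply J_linear).
  apply ell_plus; now apply J_dom.
Qed.

(** The increment is [ell] of the integral over [[s, t]], a positive element of [dom A]. This
    replaces integration of the series by a bound at the final time. *)
Lemma c_mono n s t u : 0 <= s <= t -> cone u -> c n s u <= c n t u.
Proof.
  intros Hs Hu.
  enough (H : 0 <= ell (minus (J n t u) (J n s u))).
  { rewrite ell_minus in H by (apply J_dom; lra); unfold c; lra. }
  apply ell_ge0; [apply A_minus; apply J_dom; lra|].
  apply (is_RInt_in_cone cone HX (fun r => Vn n r u) s t); [lra| |].
  - intros r Hr; apply Vn_cone; [lra|easy].
  - replace t with (s + (t - s)) by ring.
    apply (is_RInt_orbit_from _ _ Vn_toeplitz n s (t - s) u); lra.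
Qed.

(** The contribution of [B] in each term cancels against [BJ_pred] in the next; the one left over
    has a favourable sign for positive [u]. *)
Lemma c_sum N t u : 0 <= t ->
  sum_n (fun n => c n t u) N = Psi u - sum_n (fun n => Psi (Vn n t u)) N - Psi (B (J N t u)).
Proof.
  intro Ht; induction N as [|N IH].
  - rewrite !sum_O; unfold c, ell; destruct (J_maps 0 t u Ht) as [_ ->].
    rewrite !Psi_minus, Vn_0_0; simpl.
    change (Psi zero) with (Psi (zero : X)); rewrite (linear_zero Psi Psi_linear).
    change (@zero R_NormedModule) with 0; ring.
  - rewrite !sum_Sn, IH; unfold c at 1, ell; destruct (J_maps (S N) t u Ht) as [_ ->].
    rewrite !Psi_minus, Vn_S_0; simpl BJ_pred.
    rewrite (linear_zero Psi Psi_linear).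
    change (@zero R_NormedModule) with 0; unfold plus; simpl; ring.
Qed.

Lemma sum_Psi_ge N t u : 0 <= t -> cone u ->
  Psi (U t u) <= sum_n (fun n => Psi (Vn n t u)) N.
Proof.
  intros Ht Hu; induction N as [|N IH].
  - rewrite sum_O, Vn_O by easy; lra.
  - rewrite sum_Sn; pose proof (Psi_ge0 _ (Vn_cone (S N) t u Ht Hu)).
    change (Psi (U t u) <= sum_n (fun n => Psi (Vn n t u)) N + Psi (Vn (S N) t u)); lra.
Qed.

Lemma c_sum_le N t u : 0 <= t -> cone u -> sum_n (fun n => c n t u) N <= Psi u - Psi (U t u).
Proof.
  intros Ht Hu; rewrite c_sum by easy; pose proof (sum_Psi_ge N t u Ht Hu).
  pose proof (Psi_ge0 _ (B_cone _ (J_dom N t u Ht) (J_cone N t u Ht Hu))); lra.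
Qed.

Lemma c_series_cone t u : 0 <= t -> cone u -> ex_series (fun n => c n t u).
Proof.
  intros Ht Hu.
  destruct (ex_finite_lim_seq_incr (sum_n (fun n => c n t u)) (Psi u - Psi (U t u))) as [l Hl].
  - intro n; rewrite sum_Sn; pose proof (c_ge0 (S n) t u Ht Hu).
    change (sum_n (fun n => c n t u) n <= sum_n (fun n => c n t u) n + c (S n) t u); lra.
  - intro n; now apply c_sum_le.
  - now exists l.
Qed.

Lemma c_series t u : 0 <= t -> ex_series (fun n => c n t u).
Proof.
  intro Ht; destruct (Hdec u) as (v & w & Hv & Hw & E & _ & _); rewrite E.
  apply (ex_series_ext (fun n => minus (c n t v) (c n t w))).
  { intro n; symmetry; now apply c_minus. }
  apply (ex_series_minus (V := R_NormedModule)); now apply c_series_cone.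
Qed.

Lemma sigma_series t u : 0 <= t -> is_series (fun n => c n t u) (sigma t u).
Proof. intro Ht; apply Series_correct; now apply c_series. Qed.

Lemma sigma_minus t u v : 0 <= t -> sigma t (minus u v) = sigma t u - sigma t v.
Proof.
  intro Ht; unfold sigma; rewrite <- Series_minus by (now apply c_series).
  apply Series_ext; intro n; now apply c_minus.
Qed.

Lemma sigma_lim t u : 0 <= t -> is_lim_seq (sum_n (fun n => c n t u)) (sigma t u).
Proof. intro Ht; exact (sigma_series t u Ht). Qed.

Lemma sigma_cone t u : 0 <= t -> cone u -> 0 <= sigma t u <= Psi u - Psi (U t u).
Proof.
  intros Ht Hu; split.
  - apply (is_lim_seq_le (fun _ => 0) (sum_n (fun n => c n t u)) 0 (sigma t u));
      [|apply is_lim_seq_const|now apply sigma_lim].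
    intro n; induction n as [|n IH]; [rewrite sum_O; now apply c_ge0|].
    rewrite sum_Sn; apply Rplus_le_le_0_compat; [easy|now apply c_ge0].
  - apply (is_lim_seq_le (sum_n (fun n => c n t u)) (fun _ => Psi u - Psi (U t u))
      (sigma t u) (Psi u - Psi (U t u))); [|now apply sigma_lim|apply is_lim_seq_const].
    intro n; now apply c_sum_le.
Qed.

(** Integrating in time turns [ell], which is only graph-continuous, into a functional bounded on
    all of [X]; this permits approximation by elements of [dom A]. *)
Lemma sigma_bound t u : 0 <= t -> Rabs (sigma t u) <= 2 * C * norm u.
Proof.
  intro Ht; replace (2 * C) with (2 * C * 1) by ring.
  apply (bound_of_cone (fun u => Rabs (sigma t u))); [lra| |].
  - intros x y; rewrite sigma_minus by easy.
    eapply Rle_trans; [apply Rabs_triang|]; rewrite Rabs_Ropp; lra.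
  - intros x Hx; destruct (sigma_cone t x Ht Hx) as [H1 H2].
    rewrite Rabs_pos_eq by easy; rewrite Rmult_1_l, <- Psi_norm by easy.
    pose proof (Psi_ge0 _ (ss_positive _ _ HU t x Ht Hx)); lra.
Qed.

(** * Integration of the functional along orbits and passage to the closure *)

Lemma ex_RInt_J n t u : 0 <= t -> ex_RInt (fun s => J n s u) 0 t.
Proof.
  intro Ht; apply (ex_RInt_modulus _ (fun h => h * (2 * C * norm u))); [| |lra].
  - intros r h Hr Hh.
    replace (h * (2 * C * norm u)) with ((r + h - r) * (2 * C * norm u)) by ring.
    apply (norm_RInt_le_const (fun s => Vn n s u) r (r + h)); [lra| |].
    + intros s Hs; apply Vn_bound; lra.
    + apply (is_RInt_orbit_from _ _ Vn_toeplitz n r h u); lra.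
  - assert (H : rlim (fun h => h * (2 * C * norm u)) (0 * (2 * C * norm u))).
    { apply (rlim_scal_fun (V := R_NormedModule) _ _ (fun _ => 2 * C * norm u));
        [apply rlim_id|apply rlim_const]. }
    now rewrite Rmult_0_l in H.
Qed.

Lemma ex_RInt_linear (K : X -> X) (f : R -> X) a b : is_linear K ->
  ex_RInt f a b -> ex_RInt (fun s => K (f s)) a b.
Proof. intros HK [I HI]; exists (K I); now apply is_RInt_linear. Qed.

(** [J_maps] expresses the image under [A] by a continuous orbit and the image of the preceding [J]
    under [B], integrable by induction; [L] then transfers integrability from [A] to [B]. *)
Lemma ex_RInt_A_B_J n t u : 0 <= t ->
  ex_RInt (fun s => A (J n s u)) 0 t /\ ex_RInt (fun s => B (J n s u)) 0 t.
Proof.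
  intro Ht; induction n as [n IH] using (well_founded_induction Nat.lt_wf_0).
  assert (H : ex_RInt (fun s => A (J n s u)) 0 t).
  { apply (ex_RInt_ext (fun s => minus (minus (Vn n s u) (Vn n 0 u)) (BJ_pred n s u))).
    { intros s Hs; rewrite Rmin_left in Hs by easy; symmetry; apply J_maps; lra. }
    apply (ex_RInt_minus (V := X)); [apply (ex_RInt_minus (V := X))|].
    - eexists; now apply J_is_RInt.
    - apply (ex_RInt_const (V := X)).
    - destruct n as [|m]; [exact (ex_RInt_const (V := X) 0 t zero)|].
      apply (IH m); lia. }
  split; [exact H|].
  apply (ex_RInt_ext (fun s => L (minus (J n s u) (A (J n s u))))).
  { intros s Hs; rewrite Rmin_left in Hs by easy; symmetry; apply HBL, J_dom; lra. }
  apply (ex_RInt_linear L); [easy|].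
  apply (ex_RInt_minus (V := X)); [now apply ex_RInt_J|exact H].
Qed.

Lemma Vn_0_dom n v : dom A v -> dom A (Vn n 0 v).
Proof.
  intro Dv; destruct n as [|n]; [now rewrite Vn_0_0|].
  rewrite Vn_S_0; apply A_zero.
Qed.

Lemma J_pred_dom n t u : 0 <= t -> dom A (J_pred n t u).
Proof. intro Ht; destruct n as [|n]; [apply A_zero|now apply J_dom]. Qed.

Lemma Vn_eq n t v : 0 <= t -> dom A v ->
  Vn n t v = plus (Vn n 0 v) (plus (J n t (A v)) (J_pred n t (B v))).
Proof. intros Ht Dv; rewrite <- (Vn_minus n t v Ht Dv); module_eq. Qed.

Lemma Vn_dom n t v : 0 <= t -> dom A v ->
  dom A (Vn n t v) /\
  A (Vn n t v) = plus (A (Vn n 0 v)) (plus (A (J n t (A v))) (A (J_pred n t (B v)))).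
Proof.
  intros Ht Dv.
  destruct (A_plus (J n t (A v)) (J_pred n t (B v))) as [D1 E1];
    [now apply J_dom|now apply J_pred_dom|].
  destruct (A_plus (Vn n 0 v) (plus (J n t (A v)) (J_pred n t (B v)))) as [D2 E2];
    [now apply Vn_0_dom|easy|].
  rewrite E1 in E2; rewrite (Vn_eq n t v Ht Dv) at 1 2; now split.
Qed.

Lemma ell_Vn n t v : 0 <= t -> dom A v ->
  ell (Vn n t v) = ell (Vn n 0 v) + (c n t (A v) + c_pred n t (B v)).
Proof.
  intros Ht Dv; rewrite (Vn_eq n t v Ht Dv).
  pose proof (J_dom n t (A v) Ht); pose proof (J_pred_dom n t (B v) Ht).
  rewrite !ell_plus; try easy; [|now apply Vn_0_dom|now apply A_plus].
  unfold c, c_pred, J_pred; destruct n; [now rewrite ell_zero|easy].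
Qed.

(* Commuting [ell] with the integral is legitimate because, for [v] in [dom A],
   the orbit [s |-> Vn n s v] is integrable for the graph norm of [A]. *)
Lemma c_integral n t v : 0 <= t -> dom A v -> is_RInt (fun s => ell (Vn n s v)) 0 t (c n t v).
Proof.
  intros Ht Dv.
  assert (HA1 : ex_RInt (fun s => A (Vn n s v)) 0 t).
  { apply (ex_RInt_ext (fun s => plus (A (Vn n 0 v)) (plus (A (J n s (A v))) (A (J_pred n s (B v)))))).
    { intros s Hs; rewrite Rmin_left in Hs by easy; symmetry; apply Vn_dom; [lra|easy]. }
    apply (ex_RInt_plus (V := X)); [apply (ex_RInt_const (V := X))|].
    apply (ex_RInt_plus (V := X)); [now apply ex_RInt_A_B_J|].
    destruct n as [|m]; [exact (ex_RInt_const (V := X) 0 t (A zero))|now apply ex_RInt_A_B_J]. }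
  destruct HA1 as [I' HI'].
  pose proof (J_is_RInt n t v Ht) as HI.
  assert (HM : maps A (J n t v) I').
  { apply (is_RInt_generator (2 * C) U A U_C0 twice_C_ge0 U_bound HA (fun s => Vn n s v) 0 t); try easy.
    intros s Hs; apply Vn_dom; [lra|easy]. }
  destruct HM as [DJ EJ].
  assert (HB' : is_RInt (fun s => B (Vn n s v)) 0 t (B (J n t v))).
  { rewrite HBL, EJ by easy.
    apply (is_RInt_ext (fun s => L (minus (Vn n s v) (A (Vn n s v))))).
    { intros s Hs; rewrite Rmin_left in Hs by easy; symmetry; apply HBL, Vn_dom; [lra|easy]. }
    apply (is_RInt_linear L); [easy|]; now apply (is_RInt_minus (V := X)). }
  rewrite <- EJ in HI'.
  apply (is_RInt_opp (V := R_NormedModule)), (is_RInt_plus (V := R_NormedModule)).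
  - exact (is_RInt_linear Psi Psi_linear _ _ _ _ HI').
  - exact (is_RInt_linear Psi Psi_linear _ _ _ _ HB').
Qed.

(** The index shift in [c_pred] leaves the sum for [B v] one term short of the sum for [A v]; the
    missing term is the remainder. *)
Lemma ell_Vn_sum N t v : 0 <= t -> dom A v ->
  sum_n (fun n => ell (Vn n t v)) N =
  ell v + sum_n (fun n => c n t (plus (A v) (B v))) N - c N t (B v).
Proof.
  intros Ht Dv; induction N as [|N IH].
  - rewrite !sum_O, ell_Vn, Vn_0_0, c_plus by easy; simpl; ring.
  - rewrite !sum_Sn, IH, ell_Vn, Vn_S_0, ell_zero, c_plus by easy; unfold plus; simpl; ring.
Qed.

(** [ell_Vn_sum] is integrated over [[0, t]] and its integrand bounded by values at [t]. Both
    [A v + B v] and [B v] are split into positive parts because [c_mono] requires positivity. *)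
Lemma c_sum_estimate N t v w1 w2 b1 b2 : 0 <= t -> dom A v ->
  cone w1 -> cone w2 -> plus (A v) (B v) = minus w1 w2 ->
  cone b1 -> cone b2 -> B v = minus b1 b2 ->
  Rabs (sum_n (fun n => c n t v) N - t * ell v) <=
  t * (sum_n (fun n => c n t w1) N + sum_n (fun n => c n t w2) N + (c N t b1 + c N t b2)).
Proof.
  intros Ht Dv Cw1 Cw2 Ew Cb1 Cb2 Eb.
  assert (H : is_RInt (fun s => minus (sum_n (fun n => ell (Vn n s v)) N) (ell v)) 0 t
    (minus (sum_n (fun n => c n t v) N) (scal (t - 0) (ell v)))).
  { apply (is_RInt_minus (V := R_NormedModule)); [|apply (is_RInt_const (V := R_NormedModule))].
    apply (is_RInt_sum_n (V := R_NormedModule) (fun n s => ell (Vn n s v))).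
    intros n _; now apply c_integral. }
  apply norm_RInt_le_const with (M := sum_n (fun n => c n t w1) N + sum_n (fun n => c n t w2) N
    + (c N t b1 + c N t b2)) in H; [|easy|].
  { rewrite !Rminus_0_r in H; exact H. }
  intros s Hs; rewrite ell_Vn_sum, Ew by (lra || easy).
  assert (Hm : forall u, cone u -> 0 <= sum_n (fun n => c n s u) N <= sum_n (fun n => c n t u) N).
  { intros u Hu; clear H; split.
    - induction N as [|N IH]; [rewrite sum_O; apply c_ge0; lra || easy|].
      rewrite sum_Sn; apply Rplus_le_le_0_compat; [easy|apply c_ge0; lra || easy].
    - induction N as [|N IH]; [rewrite !sum_O; now apply c_mono|].
      rewrite !sum_Sn; apply Rplus_le_compat; [easy|now apply c_mono]. }
  assert (E1 : sum_n (fun n => c n s (minus w1 w2)) N =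
    sum_n (fun n => c n s w1) N - sum_n (fun n => c n s w2) N).
  { etransitivity; [|exact (sum_n_minus (V := R_NormedModule) (fun n => c n s w1) (fun n => c n s w2) N)].
    apply sum_n_ext; intro n; apply c_minus; lra. }
  rewrite E1, Eb, c_minus by lra.
  pose proof (Hm w1 Cw1); pose proof (Hm w2 Cw2).
  pose proof (c_ge0 N s b1 ltac:(lra) Cb1); pose proof (c_ge0 N s b2 ltac:(lra) Cb2).
  pose proof (c_mono N s t b1 Hs Cb1); pose proof (c_mono N s t b2 Hs Cb2).
  match goal with |- norm ?e <= _ => change (norm e) with (Rabs e) end.
  unfold minus, plus, opp; simpl; apply Rabs_le; lra.
Qed.

Lemma sigma_estimate t v w1 w2 : 0 <= t -> dom A v -> cone w1 -> cone w2 ->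
  plus (A v) (B v) = minus w1 w2 ->
  Rabs (sigma t v - t * ell v) <= t * (sigma t w1 + sigma t w2).
Proof.
  intros Ht Dv C1 C2 E; destruct (Hdec (B v)) as (b1 & b2 & Cb1 & Cb2 & Eb & _ & _).
  (* This removes the two remainder terms coming from [B v]. *)
  assert (H : forall u, is_lim_seq (fun n => c n t u) 0).
  { intro u; apply ex_series_lim_0; now apply c_series. }
  apply (is_lim_seq_le (fun N => Rabs (sum_n (fun n => c n t v) N - t * ell v))
    (fun N => t * (sum_n (fun n => c n t w1) N + sum_n (fun n => c n t w2) N + (c N t b1 + c N t b2)))
    (Rabs (sigma t v - t * ell v)) (t * (sigma t w1 + sigma t w2))).
  - intro N; now apply c_sum_estimate.
  - apply (is_lim_seq_abs _ (Finite (sigma t v - t * ell v))).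
    apply is_lim_seq_minus'; [now apply sigma_lim|apply is_lim_seq_const].
  - replace (t * (sigma t w1 + sigma t w2)) with (t * (sigma t w1 + sigma t w2 + (0 + 0))) by ring.
    apply (is_lim_seq_scal_l _ t (Finite (sigma t w1 + sigma t w2 + (0 + 0)))).
    apply is_lim_seq_plus'; [apply is_lim_seq_plus'; now apply sigma_lim|].
    apply is_lim_seq_plus'; apply H.
Qed.

Lemma sigma_closure t u w w1 w2 : 0 <= t -> cone w1 -> cone w2 -> w = minus w1 w2 ->
  (forall eps, 0 < eps -> exists x, dom A x /\ norm (minus x u) < eps /\
     norm (minus (plus (A x) (B x)) w) < eps) ->
  Rabs (sigma t u + t * Psi w) <=
  t * ((Psi w1 - Psi (U t w1)) + (Psi w2 - Psi (U t w2))).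
Proof.
  intros Ht C1 C2 Ew H; apply le_epsilon; intros eps He.
  (* The errors are [2 * C * d] from replacing [u] by [x], [2 * t * C * d] from adding [p] and [q]
     to [w1] and [w2], and [t * C * d] from [Psi p - Psi q]; their sum is at most [eps]. *)
  set (d := eps / (2 * C * (1 + 2 * t))).
  assert (Hden : 0 < 2 * C * (1 + 2 * t)) by (apply Rmult_lt_0_compat; lra).
  assert (Hd : 0 < d) by (now apply Rdiv_lt_0_compat).
  destruct (H d Hd) as (x & Dx & Hx & Hw).
  destruct (Hdec (minus (plus (A x) (B x)) w)) as (p & q & Cp & Cq & Epq & Np & Nq).
  assert (Np' : Psi p <= C * d).
  { rewrite Psi_norm by easy; eapply Rle_trans; [exact Np|]; apply Rmult_le_compat_l; lra. }
  assert (Nq' : Psi q <= C * d).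
  { rewrite Psi_norm by easy; eapply Rle_trans; [exact Nq|]; apply Rmult_le_compat_l; lra. }
  assert (E : plus (A x) (B x) = minus (plus w1 p) (plus w2 q)).
  { transitivity (plus (minus p q) w); [rewrite <- Epq; module_eq|rewrite Ew; module_eq]. }
  pose proof (sigma_estimate t x _ _ Ht Dx (cone_add _ _ C1 Cp) (cone_add _ _ C2 Cq) E) as H1.
  assert (H2 : forall a b, cone a -> cone b -> sigma t (plus a b) <= Psi a - Psi (U t a) + Psi b).
  { intros a b Ca Cb; destruct (sigma_cone t (plus a b) Ht (cone_add _ _ Ca Cb)) as [_ K].
    rewrite (linear_plus (U t)), !Psi_plus in K by (apply (sg_bounded _ U_C0), Ht).
    pose proof (Psi_ge0 _ (ss_positive _ _ HU t b Ht Cb)); lra. }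
  pose proof (H2 w1 p C1 Cp) as H3; pose proof (H2 w2 q C2 Cq) as H4.
  pose proof (sigma_bound t (minus x u) Ht) as H5; rewrite sigma_minus in H5 by easy.
  assert (H6 : 2 * C * norm (minus x u) <= 2 * C * d) by (apply Rmult_le_compat_l; lra).
  assert (H7 : ell x = - (Psi w + (Psi p - Psi q))).
  { unfold ell; rewrite <- Psi_plus, E, Ew, !Psi_minus, !Psi_plus; ring. }
  pose proof (Psi_ge0 p Cp); pose proof (Psi_ge0 q Cq).
  set (h := Psi w1 - Psi (U t w1) + (Psi w2 - Psi (U t w2))).
  assert (K1 : t * (sigma t (plus w1 p) + sigma t (plus w2 q)) <= t * (h + 2 * (C * d))).
  { apply Rmult_le_compat_l; [easy|unfold h; lra]. }
  assert (K2 : Rabs (t * (Psi p - Psi q)) <= t * (C * d)).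
  { rewrite Rabs_mult, (Rabs_pos_eq t) by easy; apply Rmult_le_compat_l; [easy|].
    apply Rabs_le; lra. }
  replace (sigma t u + t * Psi w) with
    ((sigma t x - t * ell x) + (- (sigma t x - sigma t u) + - (t * (Psi p - Psi q))))
    by (rewrite H7; ring).
  eapply Rle_trans; [apply Rabs_triang|].
  eapply Rle_trans; [apply Rplus_le_compat_l, Rabs_triang|].
  rewrite !Rabs_Ropp.
  assert (Ed : 2 * C * (1 + 2 * t) * d = eps) by (unfold d; field; lra).
  assert (0 <= t * (C * d)) by (apply Rmult_le_pos; [easy|apply Rmult_le_pos; lra]).
  lra.
Qed.

Lemma sigma_rlim u w :
  (forall eps, 0 < eps -> exists x, dom A x /\ norm (minus x u) < eps /\
     norm (minus (plus (A x) (B x)) w) < eps) ->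
  rlim (fun t => / t * sigma t u) (- Psi w).
Proof.
  intro H; destruct (Hdec w) as (w1 & w2 & C1 & C2 & Ew & _ & _).
  apply (rlim_norm_le (V := R_NormedModule) _ _
    (fun t => (Psi w1 - Psi (U t w1)) + (Psi w2 - Psi (U t w2)))).
  - intros t Ht; change (Rabs (/ t * sigma t u + - - Psi w) <=
      (Psi w1 - Psi (U t w1)) + (Psi w2 - Psi (U t w2))).
    apply Rmult_le_reg_l with t; [easy|].
    rewrite <- (Rabs_pos_eq t) at 1 by lra; rewrite <- Rabs_mult.
    replace (t * (/ t * sigma t u + - - Psi w)) with (sigma t u + t * Psi w) by (field; lra).
    apply sigma_closure; try easy; lra.
  - assert (K : forall v, rlim (fun t => minus (Psi v) (Psi (U t v))) 0).
    { intro v.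
      assert (K : rlim (fun t => minus (Psi v) (Psi (U t v))) (minus (Psi v) (Psi v))).
      { apply (rlim_minus (V := R_NormedModule) (fun _ => Psi v)); [apply rlim_const|].
        apply (rlim_linear Psi), (sg_continuous _ U_C0); apply Psi_linear. }
      now rewrite (minus_eq_zero (G := R_AbelianGroup) (Psi v)) in K. }
    pose proof (rlim_plus (V := R_NormedModule) _ _ _ _ (K w1) (K w2)) as K'.
    now rewrite (plus_zero_l (G := R_AbelianGroup)) in K'.
Qed.

Lemma ahat_closure (G : pfun X X) (V : R -> X -> X)
  (HV : @substochastic X0 cone V) (HG : @generator X0 V G) (HGe : extends (@padd X0 A B) G) u :
  @dom_closure X0 (padd A B) u -> @is_ahat X0 Psi A G Vn u (a0_fun Psi G u).
Proof.
  intros [w Hw].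
  assert (Hw' : forall eps, 0 < eps -> exists x, dom A x /\ norm (minus x u) < eps /\
     norm (minus (plus (A x) (B x)) w) < eps).
  { intros eps He; destruct (Hw eps He) as (x & [Dx _] & H1 & H2); exists x; easy. }
  assert (Gmaps : forall x, dom A x -> maps G x (plus (A x) (B x))).
  { intros x Dx; apply HGe; split; [|easy]; split; [easy|now apply HBdom]. }
  (* The vector [w] from the closure of the graph is thereby identified as [G u], so the limit does
     not depend on the approximating elements. *)
  assert (Gu : maps G u w).
  { apply (generator_closed (2 * C) V G (ss_C0 _ _ HV) twice_C_ge0); [|exact HG|].
    - intros t x Ht; now apply substochastic_bound.
    - intros eps He; destruct (Hw' eps He) as (x & Dx & H1 & H2).
      exists x, (plus (A x) (B x)); repeat split; try easy; apply Gmaps, Dx. }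
  split; [apply Gu|].
  exists (fun n t => J n t u), (fun n t => c n t u), (fun t => sigma t u).
  repeat split.
  - intros n t Ht; apply J_is_RInt; lra.
  - apply Gmaps, J_dom; lra.
  - apply J_dom; lra.
  - destruct (Gmaps (J n t u)) as [_ E]; [apply J_dom; lra|].
    change (- Psi (G (J n t u)) = c n t u); rewrite E, Psi_plus; easy.
  - intros t Ht; apply sigma_series; lra.
  - change (rlim (fun t => / t * sigma t u) (- Psi (G u))).
    destruct Gu as [_ ->]; now apply sigma_rlim.
Qed.

Lemma dom_dom_closure v : dom A v -> @dom_closure X0 (padd A B) v.
Proof.
  intro Dv; exists (plus (A v) (B v)); intros eps He; exists v; repeat split.
  - easy.
  - now apply HBdom.
  - change (norm (minus v v) < eps); now rewrite norm_minus_eq0.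
  - change (norm (minus (plus (A v) (B v)) (plus (A v) (B v))) < eps); now rewrite norm_minus_eq0.
Qed.

End Perturbation.

Theorem proposition4p6
  (X : CompleteNormedModule R_AbsRing) (cone : X -> Prop) (Psi : X -> R)
  (U V : R -> X -> X) (A B G : pfun X X) (Vn : nat -> R -> X -> X)
  (HX : abstract_state_space cone)
  (HPsi : norm_functional cone Psi)
  (HU : substochastic cone U)
  (HA : generator U A)
  (HBdom : forall u, dom B u <-> dom A u)
  (HBlin : linear_pfun B)
  (HBpos : positive_pfun cone B)
  (HAB : forall u, dom A u -> cone u -> Psi (padd A B u) <= 0)
  (HV : minimal_semigroup cone A B V G)
  (HVn : dyson_phillips cone U A B Vn) :
  (forall v, dom A v -> is_ahat Psi A G Vn v (a0_fun Psi G v)) /\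
  (forall u, dom_closure (padd A B) u -> is_ahat Psi A G Vn u (a0_fun Psi G u)).
Proof.
  destruct (bounded_decomposition cone HX) as (C & HC & Hdec).
  destruct (B_resolvent cone Psi HX HPsi C HC Hdec U A B HU HA HBdom HBlin HBpos HAB) as (L & HL & HBL).
  destruct HV as [(HV & HG & HGe) _].
  assert (H : forall u, dom_closure (padd A B) u -> is_ahat Psi A G Vn u (a0_fun Psi G u)).
  { intro u.
    exact (ahat_closure cone Psi HX HPsi C HC Hdec U A B HU HA HBdom HBlin HBpos HAB
      L HL HBL Vn HVn G V HV HG HGe u). }
  split; [|exact H].
  intros v Dv; apply H.
  exact (dom_dom_closure A B HBdom v Dv).
Qed.
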